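(* Let $q\ge 4$ be a prime power. Then the Veronese code $C_q$ has exactly 9 nonzero generalized weight polynomials, namely \begin{align*} P_0(Z)&=1,\\ P_{q^2-q}(Z)&=\tbinom{q^2+q+1}{2}(Z-1),\\ P_{q^2-1}(Z)&=(q^2+q+1)q^2(Z-q)(Z-1),\\ P_{q^2}(Z)&=(q^2+q+1)(Z-1)\big(Z^2-(q^2-1)Z+2q^3-2q^2-q+1\big),\\ P_{q^2+q-3}(Z)&=\tfrac{(q^2+q+1)(q+1)q^3(q-1)^2(Z-q)(Z-1)}{24},\\ P_{q^2+q-2}(Z)&=\tfrac{(q^2+q+1)(q+1)q^3(Z-1)(Z-q)(Z-(q^2-3q+3))}{6},\\ P_{q^2+q-1}(Z)&=\tfrac{(q^2+q+1)(q+1)q(Z-1)(Z-q)\left(2Z^2-2(q^2-q)Z+(q^4-4q^3+7q^2-4q)\right)}{4},\\ P_{q^2+q}(Z)&=\tfrac{(q^2+q+1)(Z-1)}{6}\Big(6Z^4-(6q^2+6q-6)Z^3+(3q^4+3q^3-6q)Z^2\\ &\qquad-(q^6-q^5+5q^4-5q^3-6q^2+6q)Z+(q^7-4q^6+8q^5-5q^4-6q^3+9q^2-3q)\Big),\\ P_{q^2+q+1}(Z)&=\tfrac{(Z-1)(Z-q)}{24}\Big(24Z^4-24q^2Z^3+(12q^4-12q)Z^2\\ &\qquad-(4q^6-4q^5+8q^4-20q^3+12q^2)Z+(q^8-4q^7+11q^6-17q^5+12q^4-3q^3)\Big), \end{align*} and $P_w(Z)=0$ for all other $w$.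
   Context: Let $q$ be a prime power. Fix an ordering of the $q^2+q+1$ points of $\mathbb{P}^2$ over $\mathbb{F}_q$ and a coordinate representative $(x,y,z)$ of each. The Veronese code $C_q$ is the linear $[q^2+q+1,6]_q$ code with generator matrix whose columns are the vectors $(x^2,xy,xz,y^2,yz,z^2)$ for the chosen representatives. For an $[n,k]$ code $C$ over $\mathbb{F}_q$ and $i\ge1$, let $C^{(i)}=C\otimes_{\mathbb{F}_q}\mathbb{F}_{q^i}$ (the $\mathbb{F}_{q^i}$-span of $C$). The generalized weight polynomials of $C$ are the polynomials $P_w(Z)\in\mathbb{Z}[Z]$, $0\le w\le n$, uniquely determined by $P_w(q^i)=|\{c\in C^{(i)}: wt(c)=w\}|$ for all $i\ge 1$, where $wt(c)$ is the number of nonzero coordinates of $c$. *)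

(* Defs.v *)
From HB Require Import structures.
From mathcomp Require Import all_boot all_order all_algebra.

Set Implicit Arguments.
Unset Strict Implicit.
Unset Printing Implicit Defensive.

Import GRing.Theory.
Local Open Scope ring_scope.

Definition proj_representatives (F : fieldType) (d n : nat)
    (pts : 'I_n -> 'rV[F]_d) : Prop :=
  (forall j, pts j != 0) /\
  (forall v : 'rV[F]_d, v != 0 -> exists! j, exists a : F, v = a *: pts j).

Definition wt (K : fieldType) (n : nat) (c : 'rV[K]_n) : nat :=
  #|[set j | c ord0 j != 0]|.

(* For iota : F -> L a field embedding, this is the image of C (x)_F L in L^n. *)
Definition code_ext (F : finFieldType) (L : fieldType) (iota : {rmorphism F -> L})
    (n : nat) (C : {vspace 'rV[F]_n}) : {vspace 'rV[L]_n} :=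
  <<[seq map_mx iota c | c in C]>>%VS.

(* F_(q^i) is any finite field with #|F| ^ i elements, viewed as an extension of
   F through any embedding. *)
Definition is_gen_weight_poly (F : finFieldType) (n : nat)
    (C : {vspace 'rV[F]_n}) (w : nat) (P : {poly int}) : Prop :=
  forall (i : nat) (L : finFieldType) (iota : {rmorphism F -> L}),
    (1 <= i)%N -> #|L| = (#|F| ^ i)%N ->
    P.[(#|F| ^ i)%N%:Z]
      = #|[set c : 'rV[L]_n | (c \in code_ext iota C) && (wt c == w)]|%:Z.

Definition veronese (F : fieldType) (v : 'rV[F]_3) : 'rV[F]_6 :=
  let x := v ord0 (inord 0) in
  let y := v ord0 (inord 1) in
  let z := v ord0 (inord 2) in
  \row_(k < 6) [:: x ^+ 2; x * y; x * z; y ^+ 2; y * z; z ^+ 2]`_k.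

Definition veronese_gen (F : fieldType) (n : nat) (pts : 'I_n -> 'rV[F]_3) :
    'M[F]_(6, n) :=
  \matrix_(k < 6, j < n) veronese (pts j) ord0 k.

Definition veronese_code (F : fieldType) (n : nat) (pts : 'I_n -> 'rV[F]_3) :
    {vspace 'rV[F]_n} :=
  <<[seq row k (veronese_gen pts) | k : 'I_6]>>%VS.

(* Main.v *)
Require Import Defs.
From HB Require Import structures.
From mathcomp Require Import all_boot all_order all_algebra.
From mathcomp Require Import all_fingroup all_solvable all_field.
From mathcomp Require Import ring lra zify.

(* A codeword over L = F_(q^i) is a quadratic form a over L evaluated at the
   F-points of the plane; its weight is n minus the number z(a) of F-points on
   the conic a = 0.  Let lam(a) be the number of ordered pairs of distinct
   F-points whose line lies in the conic.  The pair (lam, z) takes only ten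
   values: the conic is everything, two F-lines, an F-line and at most one
   further F-point, a smooth conic defined over F up to a scalar (q + 1 points),
   or it contains no F-line and at most four F-points.  In the last but one case
   five points, no three collinear, determine the conic, hence its descent to F;
   this is where q >= 4 (q + 1 >= 5) enters.

   With Q = #|L|, counting pairs (form, configuration of points) in two ways
   gives the sums over all forms of the falling factorials of z up to order 4,
   of lam, lam * (z - q - 1) and lam * (z - q - 1) * (z - q - 2), and the number
   of smooth conics.  Each is explicit because, in coordinates adapted to a frame
   of F-points, vanishing at the configuration is a linear condition of known
   rank.  The resulting linear system for the ten multiplicities is triangular. *)

Set Implicit Arguments.
Unset Strict Implicit.
Unset Printing Implicit Defensive.

Import GRing.Theory.
Local Open Scope ring_scope.

Import Num.Theory.

(** * Vectors of length three and quadratic forms *)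

Section Vectors.
Variable F : fieldType.
Implicit Types u v w t : 'rV[F]_3.

(** Counting zeros alone would not give enough equations. Factorial moments of z stop being uniform
    at order four, where the number of conditions imposed by the points starts to depend on their
    position, and the moments up to four are too few for the zero counts that occur. The missing
    equations come from [lam]: containing an F-line is again a linear condition, of rank three, and
    once such a line is fixed the other zeros impose conditions that are easy to control. A single
    F-line and a smooth conic both have q + 1 zeros, and the sums weighted by [lam] see only the
    former; hence the separate count of smooth conics. The characteristic is arbitrary, so neither a
    symmetric matrix nor a discriminant appears. A form is handled through its values on a frame and
    the polar values on pairs of the frame, which are valid coordinates in characteristic 2 as well.
    The closed formulas have denominators 4, 6 and 24 although the polynomials are integral; this is
    settled by residues. Uniqueness of the polynomials requires a field with q^i elements for every
    i. *)

Definition cx u := u ord0 (inord 0).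
Definition cy u := u ord0 (inord 1).
Definition cz u := u ord0 (inord 2).

Lemma vec3P u v : cx u = cx v -> cy u = cy v -> cz u = cz v -> u = v.
Proof.
move=> h0 h1 h2; apply/rowP => -[[|[|[|//]]] hi].
- by have -> : Ordinal hi = inord 0 by apply/val_inj; rewrite /= inordK.
- by have -> : Ordinal hi = inord 1 by apply/val_inj; rewrite /= inordK.
- by have -> : Ordinal hi = inord 2 by apply/val_inj; rewrite /= inordK.
Qed.

Definition mk3 (x y z : F) : 'rV[F]_3 := \row_(k < 3) [:: x; y; z]`_k.

Lemma cx_mk3 x y z : cx (mk3 x y z) = x. Proof. by rewrite /cx mxE inordK. Qed.
Lemma cy_mk3 x y z : cy (mk3 x y z) = y. Proof. by rewrite /cy mxE inordK. Qed.
Lemma cz_mk3 x y z : cz (mk3 x y z) = z. Proof. by rewrite /cz mxE inordK. Qed.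

Lemma cxD u v : cx (u + v) = cx u + cx v. Proof. by rewrite /cx mxE. Qed.
Lemma cyD u v : cy (u + v) = cy u + cy v. Proof. by rewrite /cy mxE. Qed.
Lemma czD u v : cz (u + v) = cz u + cz v. Proof. by rewrite /cz mxE. Qed.
Lemma cxZ c v : cx (c *: v) = c * cx v. Proof. by rewrite /cx mxE. Qed.
Lemma cyZ c v : cy (c *: v) = c * cy v. Proof. by rewrite /cy mxE. Qed.
Lemma czZ c v : cz (c *: v) = c * cz v. Proof. by rewrite /cz mxE. Qed.
Lemma cx0 : cx 0 = 0. Proof. by rewrite /cx mxE. Qed.
Lemma cy0 : cy 0 = 0. Proof. by rewrite /cy mxE. Qed.
Lemma cz0 : cz 0 = 0. Proof. by rewrite /cz mxE. Qed.

Definition coordE := (cx_mk3, cy_mk3, cz_mk3, cxD, cyD, czD, cxZ, cyZ, czZ, cx0, cy0, cz0).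

Definition det3 u v w :=
  cx u * (cy v * cz w - cz v * cy w) - cy u * (cx v * cz w - cz v * cx w)
  + cz u * (cx v * cy w - cy v * cx w).

Definition comb3 u v w (x y z : F) := x *: u + y *: v + z *: w.

Lemma det3_rot u v w : det3 v w u = det3 u v w.
Proof. by rewrite /det3; ring. Qed.

Lemma det3_uu u w : det3 u u w = 0.
Proof. by rewrite /det3; ring. Qed.

Lemma det3_comb3 u v w u' v' x y z :
  det3 u' v' (comb3 u v w x y z) = x * det3 u' v' u + y * det3 u' v' v + z * det3 u' v' w.
Proof. by rewrite /det3 /comb3 !coordE; ring. Qed.

Lemma det3_comb_last u v w x y z : det3 u v (comb3 u v w x y z) = z * det3 u v w.
Proof. by rewrite /det3 /comb3 !coordE; ring. Qed.

Lemma cramer u v w t : det3 u v w != 0 ->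
  t = comb3 u v w (det3 t v w / det3 u v w) (det3 u t w / det3 u v w)
                  (det3 u v t / det3 u v w).
Proof.
move=> hd; apply: vec3P; rewrite /comb3 !coordE; move: hd; rewrite /det3 => hd;
  field => //.
Qed.

Lemma basisP u v w t : det3 u v w != 0 -> exists x y z, t = comb3 u v w x y z.
Proof. by move=> /(cramer t) ->; do 3!eexists. Qed.

Lemma comb3_inj u v w x y z x' y' z' : det3 u v w != 0 ->
  comb3 u v w x y z = comb3 u v w x' y' z' -> [/\ x = x', y = y' & z = z'].
Proof.
move=> hd e.
have key u' v' : det3 u' v' (comb3 u v w x y z) = det3 u' v' (comb3 u v w x' y' z').
  by rewrite e.
have z3 a b : det3 a b a = 0 by rewrite det3_rot det3_uu.
have z2 a b : det3 a b b = 0 by rewrite -det3_rot det3_uu.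
have e1 := key v w; have e2 := key w u; have e3 := key u v.
rewrite !det3_comb3 !(z2, z3, mulr0, addr0, add0r) in e1 e2 e3.
rewrite !(det3_rot u v w) in e1; rewrite !(det3_rot v w u) !(det3_rot u v w) in e2.
have f (a b : F) : a * det3 u v w = b * det3 u v w -> a = b by apply: mulIf.
by split; apply: f.
Qed.

(** At the three unit vectors the determinant gives the coordinates of the cross product of [u] and
    [v]. Once these vanish, [c] is the quotient of the coordinates of [v] and [u] at any place where
    [u] is nonzero. *)
Lemma det3_indep u v : u != 0 -> (forall w, det3 u v w = 0) -> exists c, v = c *: u.
Proof.
move=> hu hd.
have := hd (mk3 1 0 0); have := hd (mk3 0 1 0); have := hd (mk3 0 0 1).
rewrite /det3 !coordE => e1 e2 e3.
have E3 : cy u * cz v = cz u * cy v by apply/eqP; rewrite -subr_eq0 -[X in _ == X]e3;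
  apply/eqP; ring.
have E2 : cx u * cz v = cz u * cx v by apply/esym/eqP; rewrite -subr_eq0 -[X in _ == X]e2;
  apply/eqP; ring.
have E1 : cx u * cy v = cy u * cx v by apply/eqP; rewrite -subr_eq0 -[X in _ == X]e1;
  apply/eqP; ring.
have [hx|hx] := eqVneq (cx u) 0; last first.
  exists (cx v / cx u); apply: vec3P; rewrite coordE; apply: (mulfI hx).
  - by field.
  - by rewrite E1; field.
  - by rewrite E2; field.
have [hy|hy] := eqVneq (cy u) 0; last first.
  exists (cy v / cy u); apply: vec3P; rewrite coordE; apply: (mulfI hy).
  - by rewrite -E1; field.
  - by field.
  - by rewrite E3; field.
have [hz|hz] := eqVneq (cz u) 0; last first.
  exists (cz v / cz u); apply: vec3P; rewrite coordE; apply: (mulfI hz).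
  - by rewrite -E2; field.
  - by rewrite -E3; field.
  - by field.
by case/eqP: hu; apply: vec3P; rewrite ?coordE.
Qed.

End Vectors.

Section Forms.
Variables (F L : fieldType) (iota : {rmorphism F -> L}).
Implicit Types (u v w t : 'rV[F]_3) (a b : 'rV[L]_6).

Definition qf a v : L := \sum_(k < 6) a ord0 k * iota (veronese v ord0 k).

(** The polar form without a factor 1/2: in every characteristic it is the mixed coefficient of the
    form restricted to the span of [u] and [v]. *)
Definition pol a u v : L := qf a (u + v) - qf a u - qf a v.

Lemma qfE a v : qf a v =
  a ord0 (inord 0) * iota (cx v) ^+ 2 + a ord0 (inord 1) * (iota (cx v) * iota (cy v))
  + a ord0 (inord 2) * (iota (cx v) * iota (cz v)) + a ord0 (inord 3) * iota (cy v) ^+ 2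
  + a ord0 (inord 4) * (iota (cy v) * iota (cz v)) + a ord0 (inord 5) * iota (cz v) ^+ 2.
Proof.
rewrite /qf !big_ord_recl big_ord0 addr0 !mxE -!addrA /= !rmorphM /=.
rewrite /cx /cy /cz.
by do ![congr (_ + _)]; congr (a _ _ * _); apply/val_inj; rewrite /= inordK.
Qed.

Lemma polE a u v : pol a u v =
  2 * a ord0 (inord 0) * (iota (cx u) * iota (cx v))
  + a ord0 (inord 1) * (iota (cx u) * iota (cy v) + iota (cx v) * iota (cy u))
  + a ord0 (inord 2) * (iota (cx u) * iota (cz v) + iota (cx v) * iota (cz u))
  + 2 * a ord0 (inord 3) * (iota (cy u) * iota (cy v))
  + a ord0 (inord 4) * (iota (cy u) * iota (cz v) + iota (cy v) * iota (cz u))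
  + 2 * a ord0 (inord 5) * (iota (cz u) * iota (cz v)).
Proof. by rewrite /pol !qfE !coordE !rmorphD /=; ring. Qed.

Lemma qf_comb3 a u v w x y z : qf a (comb3 u v w x y z) =
  iota x ^+ 2 * qf a u + iota y ^+ 2 * qf a v + iota z ^+ 2 * qf a w
  + iota x * iota y * pol a u v + iota x * iota z * pol a u w + iota y * iota z * pol a v w.
Proof. by rewrite !polE !qfE /comb3 !coordE !rmorphD !rmorphM /=; ring. Qed.

Lemma pol_comb3 a u v w x y z x' y' z' : pol a (comb3 u v w x y z) (comb3 u v w x' y' z') =
  2 * iota x * iota x' * qf a u + 2 * iota y * iota y' * qf a v + 2 * iota z * iota z' * qf a w
  + (iota x * iota y' + iota x' * iota y) * pol a u v
  + (iota x * iota z' + iota x' * iota z) * pol a u w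
  + (iota y * iota z' + iota y' * iota z) * pol a v w.
Proof. by rewrite !polE !qfE /comb3 !coordE !rmorphD !rmorphM /=; ring. Qed.

Lemma qfZ a c v : qf a (c *: v) = iota c ^+ 2 * qf a v.
Proof. by rewrite !qfE !coordE !rmorphM /=; ring. Qed.

Lemma polC a u v : pol a u v = pol a v u.
Proof. by rewrite !polE; ring. Qed.

Lemma qfB a b v : qf (a - b) v = qf a v - qf b v.
Proof. by rewrite !qfE !mxE; ring. Qed.

(** The unit vectors recover the coefficients of the squares, and then their pairwise sums recover
    the mixed coefficients. *)
Lemma qf_eq0 a : (forall v, qf a v = 0) -> a = 0.
Proof.
move=> h.
have e1 := h (mk3 1 0 0); have e2 := h (mk3 0 1 0); have e3 := h (mk3 0 0 1).
have e4 := h (mk3 1 1 0); have e5 := h (mk3 1 0 1); have e6 := h (mk3 0 1 1).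
move: e1 e2 e3 e4 e5 e6; rewrite !qfE !coordE !(rmorph1, rmorph0).
rewrite !(expr1n, expr0n, mulr0, mul0r, mulr1, addr0, add0r) /= ?mulr0 ?addr0 ?add0r.
move=> e0 e3 e5; rewrite e0 e3 e5 ?addr0 ?add0r => e1 e2 e4.
apply/rowP => -[[|[|[|[|[|[|//]]]]]] hi]; rewrite mxE.
- by rewrite -e0; congr (a _ _); apply/val_inj; rewrite /= inordK.
- by rewrite -e1; congr (a _ _); apply/val_inj; rewrite /= inordK.
- by rewrite -e2; congr (a _ _); apply/val_inj; rewrite /= inordK.
- by rewrite -e3; congr (a _ _); apply/val_inj; rewrite /= inordK.
- by rewrite -e4; congr (a _ _); apply/val_inj; rewrite /= inordK.
- by rewrite -e5; congr (a _ _); apply/val_inj; rewrite /= inordK.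
Qed.

(* The six values determine the form, since they are its coefficients in the
   basis (u, v, w). *)
Definition coef a u v w : L * L * L * L * L * L :=
  (qf a u, qf a v, qf a w, pol a u v, pol a u w, pol a v w).

Lemma coef_inj u v w : det3 u v w != 0 -> injective (fun a => coef a u v w).
Proof.
move=> hd a b [e1 e2 e3 e4 e5 e6]; apply/eqP; rewrite -subr_eq0; apply/eqP/qf_eq0 => t.
by have [x [y [z ->]]] := basisP t hd; rewrite qfB !qf_comb3 e1 e2 e3 e4 e5 e6 subrr.
Qed.
End Forms.

(** * Counting forms by their coordinates in a frame *)

Section CountForms.
Variables (F : fieldType) (L : finFieldType) (iota : {rmorphism F -> L}).
Local Notation L6 := (L * L * L * L * L * L)%type.

(** An injection between two sets with #|L|^6 elements is a bijection. Thus each condition on forms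
    may be counted in whichever frame makes it simplest. *)
Lemma card_coef (u v w : 'rV[F]_3) (R : pred L6) : det3 u v w != 0 ->
  #|[set a | R (coef iota a u v w)]| = #|[set c | R c]|.
Proof.
move=> hd; have inj := coef_inj (iota := iota) hd.
have [g gK Kg] : bijective (fun a => coef iota a u v w).
  apply: inj_card_bij => //.
  by rewrite card_mx !card_prod mul1n !expnS expn0 muln1 !mulnA.
rewrite -(card_imset _ inj); apply: eq_card => c; rewrite !inE.
apply/imsetP/idP => [[a]|hc]; first by rewrite inE => ha ->.
by exists (g c); rewrite ?inE Kg.
Qed.

Lemma card_graph (T : finType) (P : pred T) (f : T -> L) :
  #|[set c : T * L | P c.1 && (c.2 == f c.1)]| = #|[set t | P t]|.
Proof.
rewrite -(card_imset (f := fun t => (t, f t)) [set t | P t]); last by move=> x y [].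
apply: eq_card => -[t l]; rewrite !inE /=; apply/andP/imsetP => [[hp /eqP->]|[t']].
  by exists t; rewrite ?inE.
by rewrite inE => ht' [-> ->].
Qed.

End CountForms.

(** * Conics and the points and lines of the plane *)

Lemma card_offdiag (T : finType) (S : {set T}) :
  #|[set t : T * T | [&& t.1 != t.2, t.1 \in S & t.2 \in S]]| = (#|S| * #|S|.-1)%N.
Proof.
have -> : #|S|.-1 = (#|S| - 1)%N by rewrite subn1.
rewrite mulnBr muln1 -cardsX -(card_imset (f := fun x : T => (x, x)) S); last by move=> x y [].
have sub : [set (x, x) | x in S] \subset setX S S.
  by apply/subsetP => -[x y] /imsetP[z hz [-> ->]]; rewrite inE /= hz.
rewrite -(setIidPr sub) -cardsD; apply: eq_card => -[x y]; rewrite !inE /=.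
have -> : ((x, y) \in [set (x0, x0) | x0 in S]) = (x == y) && (x \in S).
  apply/imsetP/andP => [[z hz [-> ->]]|[/eqP<- hx]]; last by exists x.
  by rewrite eqxx.
by case: eqVneq => //= _; case: (x \in S).
Qed.

Section Points.
Variables (F : finFieldType) (q n : nat) (p : 'I_n -> 'rV[F]_3).
Hypotheses (hF : #|F| = q) (hn : n = (q ^ 2 + q + 1)%N) (hp : proj_representatives p).
Implicit Types (i j k l : 'I_n).

Lemma q_gt1 : (1 < q)%N.
Proof. by rewrite -hF finNzRing_gt1. Qed.

Lemma pt_neq0 i : p i != 0.
Proof. by case: hp. Qed.

Lemma pt_scale v : v != 0 -> exists i c, c != 0 /\ v = c *: p i.
Proof.
move=> hv; case: hp => _ /(_ v hv)[i [[c hc] _]]; exists i, c; split => //.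
by apply: contraNneq hv => c0; rewrite hc c0 scale0r.
Qed.

Lemma pt_inj i j c : p j = c *: p i -> i = j.
Proof.
move=> e; case: hp => _ /(_ _ (pt_neq0 j))[k [_ hk]].
by rewrite -(hk i) ?(hk j) //; [exists 1; rewrite scale1r|exists c].
Qed.

(** If all these determinants vanished, then, every nonzero vector being a multiple of a
    representative, [det3 (p i) (p j)] would vanish identically and [p j] would be a multiple of
    [p i]. *)
Lemma pt_third i j : i != j -> exists k, det3 (p i) (p j) (p k) != 0.
Proof.
move=> hij; apply/existsP; apply: contraNT hij => /existsPn h.
have [c /pt_inj ->//] : exists c, p j = c *: p i.
apply: det3_indep (pt_neq0 i) _ => w; have [->|] := eqVneq w 0.
  by rewrite /det3 !coordE; ring.
case/pt_scale => k [c [_ ->]]; have /negbNE/eqP e := h k.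
by rewrite -[RHS](mulr0 c) -e /det3 !coordE; ring.
Qed.

(** Each nonzero vector is [c *: p i] for exactly one pair with [c] nonzero. This turns counts of
    points into counts of vectors, where a frame provides coordinates. *)
Lemma card_pt (P : pred 'rV[F]_3) : (forall c v, c != 0 -> P (c *: v) = P v) ->
  #|[set v | (v != 0) && P v]| = (q.-1 * #|[set i | P (p i)]|)%N.
Proof.
move=> hP; have -> : q.-1 = #|[set~ (0 : F)]| by rewrite cardsC1 hF.
rewrite -cardsX -(card_in_imset (f := fun t : F * 'I_n => t.1 *: p t.2)).
  apply: eq_card => v; rewrite !inE; apply/andP/imsetP => [[v0 hv]|].
    have [i [c [c0 e]]] := pt_scale v0; exists (c, i) => //.
    by rewrite !inE /= c0 /= -(hP c) // -e.
  case=> -[c i]; rewrite !inE /= => /andP[c0 hi] ->; rewrite hP // hi; split => //.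
  by rewrite scaler_eq0 (negPf c0) pt_neq0.
case=> [c i] [d j]; rewrite !inE /= => /andP[c0 hi] /andP[d0 hj] e.
have ij : i = j.
  by apply: (@pt_inj i j (d^-1 * c)); rewrite -scalerA e scalerA mulVf // scale1r.
subst j; congr (_, _); apply/eqP; rewrite -subr_eq0.
by have := scaler_eq0 (c - d) (p i); rewrite scalerBl e subrr eqxx (negPf (pt_neq0 i)) orbF.
Qed.

Definition line i j := [set k | det3 (p i) (p j) (p k) == 0].

Lemma line_l i j : i \in line i j.
Proof. by rewrite inE; apply/eqP; rewrite /det3; ring. Qed.

Lemma line_r i j : j \in line i j.
Proof. by rewrite inE; apply/eqP; rewrite /det3; ring. Qed.

(** In a frame completing [i] and [j] the line consists of the vectors with last coordinate zero, so
    there are q^2 - 1 = (q - 1)(q + 1) nonzero ones. *)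
Lemma card_line i j : i != j -> #|line i j| = q.+1.
Proof.
move=> hij; have [k hk] := pt_third hij.
have q1 : (0 < q.-1)%N by have := q_gt1; case: q => [|[]].
apply/eqP; rewrite -(eqn_pmul2l q1); apply/eqP.
rewrite -(card_pt (P := fun v => det3 (p i) (p j) v == 0)); last first.
  move=> c v c0; have -> : det3 (p i) (p j) (c *: v) = c * det3 (p i) (p j) v.
    by rewrite /det3 !coordE; ring.
  by rewrite mulf_eq0 (negPf c0).
have -> : (q.-1 * q.+1 = (q ^ 2).-1)%N by have := q_gt1; case: q => [|m] // _; rewrite /=; lia.
have -> : (q ^ 2 = #|{: F * F}|)%N by rewrite card_prod hF expnS expn1.
rewrite -(cardsC1 (0 : F * F)).
rewrite -(card_imset (f := fun t : F * F => comb3 (p i) (p j) (p k) t.1 t.2 0)); last first.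
  by move=> [x y] [x' y'] /= /(comb3_inj hk)[-> ->].
have d0 t : (comb3 (p i) (p j) (p k) t.1 t.2 0 == 0) = (t == 0 :> F * F).
  case: t => x y; apply/eqP/eqP => /= [e|[-> ->]]; last first.
    by rewrite /comb3 !scale0r !addr0.
  have e0 : comb3 (p i) (p j) (p k) x y 0 = comb3 (p i) (p j) (p k) 0 0 0.
    by rewrite e /comb3 !scale0r !addr0.
  by have [-> -> _] := comb3_inj hk e0.
apply: eq_card => v; rewrite !inE; apply/andP/imsetP => [[v0 /eqP hv]|[t]]; last first.
  rewrite !inE => t0 ->; rewrite d0 t0; split => //; apply/eqP.
  by rewrite det3_comb_last mul0r.
have [x [y [z e]]] := basisP v hk; move: hv; rewrite e det3_comb_last => /eqP.
rewrite mulf_eq0 (negPf hk) orbF => /eqP z0; subst z; exists (x, y) => //.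
by rewrite !inE -(d0 (x, y)) -e.
Qed.

Variables (L : finFieldType) (iota : {rmorphism F -> L}).
Implicit Types a : 'rV[L]_6.
Local Notation qf := (qf iota).
Local Notation pol := (pol iota).
Local Notation coef := (coef iota).

Definition zeros a := [set i | qf a (p i) == 0].

(* The line through the points i and j lies in the conic a = 0. *)
Definition van a i j := [&& qf a (p i) == 0, qf a (p j) == 0 & pol a (p i) (p j) == 0].

Definition lam a := #|[set t : 'I_n * 'I_n | (t.1 != t.2) && van a t.1 t.2]|.

Lemma line_comb i j k : i != j -> k \in line i j ->
  exists x y, p k = x *: p i + y *: p j.
Proof.
move=> hij; rewrite inE => /eqP hk; have [l hl] := pt_third hij.
have [x [y [z e]]] := basisP (p k) hl; move: hk; rewrite e det3_comb_last => /eqP.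
rewrite mulf_eq0 (negPf hl) orbF => /eqP z0; subst z; exists x, y.
by rewrite /comb3 scale0r addr0.
Qed.

Lemma qf_comb2 a u v x y : qf a (x *: u + y *: v) =
  iota x ^+ 2 * qf a u + iota y ^+ 2 * qf a v + iota x * iota y * pol a u v.
Proof. by rewrite !polE !qfE !coordE !rmorphD !rmorphM /=; ring. Qed.

Lemma pol_comb2 a u v x y x' y' : pol a (x *: u + y *: v) (x' *: u + y' *: v) =
  2 * iota x * iota x' * qf a u + 2 * iota y * iota y' * qf a v
  + (iota x * iota y' + iota x' * iota y) * pol a u v.
Proof. by rewrite !polE !qfE !coordE !rmorphD !rmorphM /=; ring. Qed.

(** The three conditions in [van] are the coefficients of the restricted binary form; when they
    vanish, so do all values and polar values on the span. Hence [van] depends only on the line. *)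
Lemma van_line a i j k l : i != j -> van a i j -> k \in line i j -> l \in line i j ->
  van a k l.
Proof.
move=> hij /and3P[/eqP hi /eqP hj /eqP hp'].
move=> /(line_comb hij)[x [y e]] /(line_comb hij)[x' [y' e']].
by rewrite /van e e' !qf_comb2 pol_comb2 hi hj hp' !mulr0 !addr0 eqxx.
Qed.

Lemma van_zeros a i j : i != j -> van a i j -> line i j \subset zeros a.
Proof.
move=> hij hv; apply/subsetP => k hk; rewrite inE.
by have /and3P[] := van_line hij hv hk hk.
Qed.

Lemma van_sym a i j : van a i j = van a j i.
Proof. by rewrite /van polC; case: (qf a (p i) == 0); case: (qf a (p j) == 0). Qed.

(** A binary quadratic form with zeros at both basis vectors is a multiple of the product of the
    coordinates; a third zero has both coordinates nonzero and kills the factor. *)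
Lemma three_zeros a i j k : i != j -> k \in line i j -> k != i -> k != j ->
  i \in zeros a -> j \in zeros a -> k \in zeros a -> van a i j.
Proof.
move=> hij /(line_comb hij)[x [y e]] ki kj; rewrite !inE e qf_comb2 => /eqP hi /eqP hj.
rewrite /van hi hj eqxx !mulr0 !add0r !mulf_eq0 !fmorph_eq0 => /orP[/orP[]|] // /eqP h0.
  by case/negP: kj; apply/eqP/esym/(@pt_inj _ _ y); rewrite e h0 scale0r add0r.
by case/negP: ki; apply/eqP/esym/(@pt_inj _ _ x); rewrite e h0 scale0r addr0.
Qed.

Lemma det3_line i j k : (det3 (p i) (p j) (p k) != 0) = (k \notin line i j).
Proof. by rewrite inE. Qed.

Lemma line_det_neq i j k : det3 (p i) (p j) (p k) != 0 -> [/\ i != j, i != k & j != k].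
Proof.
move=> h; split; apply: contraNneq h => ->; apply/eqP; rewrite /det3; ring.
Qed.

Lemma line_sub i j k l : i != j -> k != l -> k \in line i j -> l \in line i j ->
  line k l = line i j.
Proof.
move=> hij hkl hk hl; apply/eqP; rewrite eqEcard !card_line // leqnn andbT.
apply/subsetP => m hm; have [x [y e]] := line_comb hkl hm.
have [x1 [y1 e1]] := line_comb hij hk; have [x2 [y2 e2]] := line_comb hij hl.
by rewrite inE e e1 e2 /det3 !coordE; apply/eqP; ring.
Qed.

Lemma no_van_det a i j k : (forall k l, k != l -> ~~ van a k l) ->
  i \in zeros a -> j \in zeros a -> k \in zeros a -> i != j -> i != k -> j != k ->
  det3 (p i) (p j) (p k) != 0.
Proof.
move=> hv hi hj hk hij hik hjk; rewrite det3_line; apply: contra (hv i j hij) => h.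
by apply: three_zeros h _ _ hi hj hk; rewrite // eq_sym.
Qed.

(* The conics over L that are scalar multiples of conics over F through the
   vertices of the frame (u, v, w) and containing no F-line. *)
Definition smooth_coef (c : L * L * L * L * L * L) := exists (b : L) (x y : F),
  [/\ b != 0, x != 0, y != 0 & c = (0, 0, 0, b, b * iota x, b * iota y)].

(** Up to the factor [b] the equation in the frame is r s + t (x r + y s) = 0 over F. Off the line x
    r + y s = 0 it determines t, giving q^2 - q solutions. On that line it forces r = s = 0 and
    leaves t free, giving q more. Removing the origin leaves q^2 - 1 = (q - 1)(q + 1) vectors. *)
Lemma card_smooth_zeros a i j k : det3 (p i) (p j) (p k) != 0 ->
  smooth_coef (coef a (p i) (p j) (p k)) -> #|zeros a| = q.+1.
Proof.
move=> hd [b [x [y [b0 x0 y0 [e1 e2 e3 e4 e5 e6]]]]].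
have q1 : (0 < q.-1)%N by have := q_gt1; case: q => [|[]].
apply/eqP; rewrite -(eqn_pmul2l q1); apply/eqP.
rewrite /zeros -(card_pt (P := fun v => qf a v == 0)); last first.
  by move=> c v c0; rewrite qfZ mulf_eq0 expf_eq0 fmorph_eq0 (negPf c0).
have -> : (q.-1 * q.+1 = (q ^ 2).-1)%N.
  by have := q_gt1; case: q => [|m] // _; rewrite /=; lia.
have hz r s t : qf a (comb3 (p i) (p j) (p k) r s t) =
    b * iota (r * s + t * (x * r + y * s)).
  by rewrite qf_comb3 e1 e2 e3 e4 e5 e6 !rmorphD !rmorphM /= !rmorphD !rmorphM /=; ring.
pose A := [set c : F * F * F | c.1.1 * c.1.2 + c.2 * (x * c.1.1 + y * c.1.2) == 0].
pose f (c : F * F * F) := comb3 (p i) (p j) (p k) c.1.1 c.1.2 c.2.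
have f_inj : injective f.
  by move=> [[r s] t] [[r' s'] t'] /(comb3_inj hd)[/= -> -> ->].
pose o : F * F * F := (0, 0, 0).
have f0 : f o = 0 by rewrite /f /comb3 !scale0r !addr0.
have -> : [set v | (v != 0) && (qf a v == 0)] = f @: (A :\ o).
  apply/setP => v; rewrite !inE; apply/andP/imsetP => [[v0 /eqP hv]|[c hc ->]].
    have [r [s [t e]]] := basisP v hd; exists (r, s, t) => //.
    rewrite !inE /=; apply/andP; split.
      by apply: contraNneq v0 => e0; rewrite e -/(f (r, s, t)) e0 f0.
    by move/eqP: hv; rewrite e hz mulf_eq0 (negPf b0) fmorph_eq0.
  move: hc; rewrite !inE => /andP[c0 /eqP hc]; rewrite /f hz hc rmorph0 mulr0 eqxx.
  by split => //; rewrite -/(f c) -f0 (inj_eq f_inj).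
rewrite card_imset //.
have A0 : o \in A by rewrite inE /= !mulr0 mul0r addr0.
have := cardsD1 o A; rewrite A0 add1n => cA; rewrite -[LHS]/(#|A :\ o|.+1.-1) -cA; congr (_.-1).
pose l (c : F * F) := x * c.1 + y * c.2.
have cl : #|[set c : F * F | l c == 0]| = q.
  rewrite -hF -cardsT -(card_graph xpredT (fun r => - x * r / y)).
  apply: eq_card => -[r s]; rewrite !inE /l /=; apply/eqP/eqP => [h|->]; last by field.
  by apply: (mulfI y0); rewrite -[LHS]subr0 -h; field.
have cl' : #|[set c : F * F | l c != 0]| = (q ^ 2 - q)%N.
  have -> : (q ^ 2 = #|{: F * F}|)%N by rewrite card_prod hF expnS expn1.
  rewrite -cl -(cardC [set c : F * F | l c == 0]) addKn; apply: eq_card => c; by rewrite !inE.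
pose A1 := [set ((0 : F, 0 : F), t) | t in F];
  pose A2 := [set c : F * F * F | (l c.1 != 0) && (c.2 == - (c.1.1 * c.1.2) / l c.1)].
have -> : A = A1 :|: A2.
  apply/setP => -[[r s] t]; rewrite !inE /=.
  have -> : ((r, s, t) \in A1) = (r == 0) && (s == 0).
    apply/imsetP/andP => [[t' _ [-> -> _]]|[/eqP-> /eqP->]]; [by rewrite !eqxx|by exists t].
  rewrite -[x * r + y * s]/(l (r, s)); have [l0|l0] := eqVneq (l (r, s)) 0.
    rewrite l0 mulr0 addr0 /= orbF mulf_eq0; move: l0; rewrite /l /=.
    have [-> /eqP|r0] := eqVneq r 0; first by rewrite mulr0 add0r mulf_eq0 (negPf y0).
    have [->|//] := eqVneq s 0.
    by move/eqP; rewrite mulr0 addr0 mulf_eq0 (negPf x0) (negPf r0).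
  rewrite /=; have -> : (r == 0) && (s == 0) = false.
    by apply: contraNF l0 => /andP[/eqP-> /eqP->]; rewrite /l /= !mulr0 addr0.
  apply/eqP/eqP => [h|->]; last by field.
  by apply: (mulfI l0); rewrite -[LHS]subr0 -h; field.
rewrite cardsU disjoint_setI0 ?cards0 ?subn0; last first.
  apply/pred0P => -[[r s] t]; rewrite /= inE /=.
  apply/negP => /andP[/imsetP[t' _ [-> -> _]]]; by rewrite /l /= !mulr0 addr0 eqxx.
rewrite (card_graph (fun c => l c != 0) (fun c => - (c.1 * c.2) / l c)) cl' card_imset;
  last by move=> ? ? [].
rewrite hF subnKC // expnS expn1 leq_pmull //; exact: ltnW q_gt1.
Qed.

Hypothesis hq : (4 <= q)%N.

(** In the frame [i], [j], [k] only the three polar values survive. The points [l] and [m] impose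
    two independent linear equations on them with coefficients in F, so their ratios lie in F. None
    of the three is zero, as the conic contains no side of the frame. *)
Lemma five_zeros a i j k l m : (forall k l, k != l -> ~~ van a k l) ->
  uniq [:: i; j; k; l; m] -> {subset [:: i; j; k; l; m] <= zeros a} ->
  det3 (p i) (p j) (p k) != 0 /\ smooth_coef (coef a (p i) (p j) (p k)).
Proof.
move=> hv hu hz.
have [hi hj hk hl hm] : [/\ i \in zeros a, j \in zeros a, k \in zeros a, l \in zeros a & m \in
  zeros a].
  by split; apply: hz; rewrite !inE eqxx ?orbT.
have D := no_van_det hv.
move: hu; rewrite /= !inE !negb_or => /and5P[/and4P[ij ik il im] /and3P[jk jl jm] /andP[kl km]
  lm _].
have hd : det3 (p i) (p j) (p k) != 0 by apply: D.
split => //.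
have [x [y [z el]]] := basisP (p l) hd; have [x' [y' [z' em]]] := basisP (p m) hd.
have d1 : det3 (p j) (p k) (p l) != 0 by apply: D.
have d2 : det3 (p i) (p k) (p l) != 0 by apply: D.
have d3 : det3 (p i) (p j) (p l) != 0 by apply: D.
have d1' : det3 (p j) (p k) (p m) != 0 by apply: D.
have d2' : det3 (p i) (p k) (p m) != 0 by apply: D.
have d3' : det3 (p i) (p j) (p m) != 0 by apply: D.
have d4 : det3 (p k) (p l) (p m) != 0 by apply: D.
have nz (r s : F) : r != 0 -> r = s * det3 (p i) (p j) (p k) -> s != 0.
  by move=> r0 e; apply: contraNneq r0 => s0; rewrite e s0 mul0r.
have z0 : z != 0 by apply: nz d3 _; rewrite el det3_comb_last.
have z0' : z' != 0 by apply: nz d3' _; rewrite em det3_comb_last.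
have x0 : x != 0 by apply: nz d1 _; rewrite el /det3 /comb3 !coordE; ring.
have x0' : x' != 0 by apply: nz d1' _; rewrite em /det3 /comb3 !coordE; ring.
have y0 : - y != 0 by apply: nz d2 _; rewrite el /det3 /comb3 !coordE; ring.
have y0' : - y' != 0 by apply: nz d2' _; rewrite em /det3 /comb3 !coordE; ring.
rewrite !oppr_eq0 in y0 y0'.
(* This minor is the determinant of [k], [l], [m] relative to the frame; it is the one inverted in
   [B] and [C]. *)
have w0 : x * y' - x' * y != 0.
  by apply: nz d4 _; rewrite el em /det3 /comb3 !coordE; ring.
move: (hi) (hj) (hk) hl hm; rewrite !inE el em !qf_comb3.
move=> /eqP fi /eqP fj /eqP fk; rewrite fi fj fk !mulr0 !add0r => /eqP hl /eqP hm.
have b1 : pol a (p i) (p j) != 0.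
  by have := hv _ _ ij; rewrite /van fi fj eqxx.
have b2 : pol a (p i) (p k) != 0.
  by have := hv _ _ ik; rewrite /van fi fk eqxx.
have b3 : pol a (p j) (p k) != 0.
  by have := hv _ _ jk; rewrite /van fj fk eqxx.
set c1 := pol a (p i) (p j) in hl hm b1 *; set c2 := pol a (p i) (p k) in hl hm b2 *.
set c3 := pol a (p j) (p k) in hl hm b3 *.
(* The equations are x y c1 + x z c2 + y z c3 = 0 and its primed version. Eliminating c3 gives [B] =
   c2 / c1, eliminating c2 gives [C] = c3 / c1. *)
pose B := - (y * y' * (x * z' - x' * z)) / (z * z' * (x * y' - x' * y)).
pose C := (x * x' * (y * z' - y' * z)) / (z * z' * (x * y' - x' * y)).
have W0 : iota z * iota z' * (iota x * iota y' - iota x' * iota y) != 0.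
  by rewrite -!rmorphM -rmorphB -rmorphM fmorph_eq0 !mulf_neq0.
have e2 : c2 = c1 * iota B.
  rewrite /B fmorph_div !(rmorphM, rmorphB, rmorphN) /= mulrA.
  apply: (canRL (mulfK W0)); apply/eqP; rewrite -subr_eq0; apply/eqP.
  by transitivity (iota y' * iota z' * 0 - iota y * iota z * 0 : L); [rewrite -{1}hl -hm|]; ring.
have e3 : c3 = c1 * iota C.
  rewrite /C fmorph_div !(rmorphM, rmorphB, rmorphN) /= mulrA.
  apply: (canRL (mulfK W0)); apply/eqP; rewrite -subr_eq0; apply/eqP.
  by transitivity (iota x * iota z * 0 - iota x' * iota z' * 0 : L); [rewrite -{1}hm -hl|]; ring.
exists c1, B, C; split => //.
- by apply: contraNneq b2 => h; rewrite e2 h rmorph0 mulr0.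
- by apply: contraNneq b3 => h; rewrite e3 h rmorph0 mulr0.
by rewrite /coef fi fj fk -/c1 -/c2 -/c3 -e2 -e3.
Qed.

Lemma lam_no_van a : (forall k l, k != l -> ~~ van a k l) -> lam a = 0%N.
Proof.
move=> hv; apply/eqP; rewrite cards_eq0; apply/eqP/setP => -[k l]; rewrite !inE /=.
by apply/negP => /andP[/hv/negP].
Qed.

Lemma no_van_zeros a : (forall k l, k != l -> ~~ van a k l) ->
  (#|zeros a| <= 4)%N \/ #|zeros a| = q.+1.
Proof.
move=> hv; have [|h5] := leqP #|zeros a| 4; [by left|right].
have : size (take 5 (enum (zeros a))) = 5%N by rewrite size_takel // -cardE.
have : uniq (take 5 (enum (zeros a))) by rewrite take_uniq ?enum_uniq.
have : {subset take 5 (enum (zeros a)) <= zeros a}.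
  by move=> x /mem_take; rewrite mem_enum.
case: (take _ _) => [|i [|j [|k [|l [|m [|]]]]]] // hs hu _.
by have [hd] := five_zeros hv hu hs; apply: card_smooth_zeros.
Qed.

Lemma lam_one_line a i j : i != j -> van a i j ->
  (forall k l, k != l -> van a k l -> (k \in line i j) && (l \in line i j)) ->
  lam a = (q.+1 * q)%N.
Proof.
move=> hij hv h; rewrite -{2}[q]/(q.+1.-1) -(card_line hij) -card_offdiag.
apply: eq_card => -[k l]; rewrite !inE /=; apply: andb_id2l => hkl.
apply/idP/andP => [/(h _ _ hkl)|[hk hl]]; first by rewrite !inE => /andP.
by apply: van_line hij hv _ _; rewrite inE.
Qed.

(** The line through [k] and [l] meets the line [i j] in a point i', which is a third zero on it, so
    the conic also contains that line. In a frame i', j', [k] with j' on the first line, only the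
    polar value at j' and [k] can survive. *)
Lemma two_zeros_off_line a i j k l : i != j -> van a i j -> k != l ->
   k \in zeros a -> l \in zeros a -> k \notin line i j -> l \notin line i j ->
   exists i' j' c, [/\ det3 (p i') (p j') (p k) != 0, line i' j' = line i j &
      coef a (p i') (p j') (p k) = (0, 0, 0, 0, 0, c)].
Proof.
move=> hij hv hkl hk hl ok ol; move: (ok); rewrite -det3_line => hd.
have [x [y [z e]]] := basisP (p l) hd.
have z0 : z != 0.
  by move: ol; rewrite -det3_line e det3_comb_last; apply: contraNneq => ->; rewrite mul0r.
have xy0 : x *: p i + y *: p j != 0.
  apply: contraNneq hkl => h; apply/eqP/(@pt_inj _ _ z).
  by rewrite e /comb3 h add0r.
(* The intersection of the lines [i j] and [k l]: the component of [p l] in the span of [p i] and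
   [p j]. *)
have [i' [c [c0 ei]]] := pt_scale xy0.
have hi' : i' \in line i j.
  rewrite inE -(mulrI_eq0 _ (mulfI c0)); apply/eqP.
  transitivity (det3 (p i) (p j) (c *: p i')); first by rewrite /det3 !coordE; ring.
  by rewrite -ei /det3 !coordE; ring.
have [j' hj' hij'] : exists2 j', j' \in line i j & i' != j'.
  have [->|ne] := eqVneq i' i; [by exists j; rewrite ?line_r|by exists i; rewrite ?line_l].
have el : line i' j' = line i j by apply: line_sub.
exists i', j', (pol a (p j') (p k)); rewrite det3_line el ok; split => //.
have /and3P[/eqP h1 /eqP h2 /eqP h3] := van_line hij hv hi' hj'.
move: (hk) (hl); rewrite !inE => /eqP hk0 /eqP.
have -> : p l = c *: p i' + z *: p k by rewrite e /comb3 ei.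
rewrite qf_comb2 h1 hk0 !mulr0 !add0r => /eqP; rewrite !mulf_eq0 !fmorph_eq0.
by rewrite (negPf c0) (negPf z0) /= => /eqP h; rewrite /coef h1 h2 h3 hk0 h.
Qed.

(* The values of (lam, z): all points, two lines, a line and a point, a line, a
   smooth conic, and at most four points with no line. *)
Definition types := [:: (n * n.-1, n); (2 * (q.+1 * q), 2 * q + 1); (q.+1 * q, q + 2);
  (q.+1 * q, q + 1); (0, q + 1); (0, 4); (0, 3); (0, 2); (0, 1); (0, 0)]%N.

(** In the frame the form is [c] y z, so the zeros are the lines z = 0 and y = 0, which share only
    the point [i]. For two zeros, the polar condition y z' + y' z = 0 says that they lie on a common
    component; as two distinct points never lie on both lines, the two sets of pairs are
    disjoint. *)
Lemma type_two_lines a i j k c : det3 (p i) (p j) (p k) != 0 -> c != 0 ->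
  coef a (p i) (p j) (p k) = (0, 0, 0, 0, 0, c) ->
  lam a = (2 * (q.+1 * q))%N /\ #|zeros a| = (2 * q + 1)%N.
Proof.
move=> hd c0 [e1 e2 e3 e4 e5 e6].
have [ij ik jk] := line_det_neq hd.
have hzero x y z : (qf a (comb3 (p i) (p j) (p k) x y z) == 0) = (z == 0) || (y == 0).
  by rewrite qf_comb3 e1 e2 e3 e4 e5 e6 !mulr0 !add0r !mulf_eq0 !fmorph_eq0 (negPf c0) orbF orbC.
have l1 x y z m : p m = comb3 (p i) (p j) (p k) x y z -> (m \in line i j) = (z == 0).
  by move=> e; rewrite inE e det3_comb_last mulf_eq0 (negPf hd) orbF.
have l2 x y z m : p m = comb3 (p i) (p j) (p k) x y z -> (m \in line i k) = (y == 0).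
  move=> e; rewrite inE e -oppr_eq0.
  have -> : - det3 (p i) (p k) (comb3 (p i) (p j) (p k) x y z) = y * det3 (p i) (p j) (p k).
    by rewrite /det3 /comb3 !coordE; ring.
  by rewrite mulf_eq0 (negPf hd) orbF.
have hI : line i j :&: line i k = [set i].
  apply/setP => m; rewrite in_setI in_set1; have [x [y [z e]]] := basisP (p m) hd.
  rewrite (l1 _ _ _ _ e) (l2 _ _ _ _ e); apply/andP/eqP => [[/eqP z0 /eqP y0]|em].
    by apply/esym/(@pt_inj _ _ x); rewrite e z0 y0 /comb3 !scale0r !addr0.
  have e' : comb3 (p i) (p j) (p k) x y z = comb3 (p i) (p j) (p k) 1 0 0.
    by rewrite -e em /comb3 !scale0r scale1r !addr0.
  by have [_ -> ->] := comb3_inj hd e'.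
have hZ : zeros a = line i j :|: line i k.
  apply/setP => m; rewrite in_setU; have [x [y [z e]]] := basisP (p m) hd.
  by rewrite (l1 _ _ _ _ e) (l2 _ _ _ _ e) inE e hzero.
split; last first.
  by rewrite hZ cardsU hI cards1 !card_line //; lia.
pose S (X : {set 'I_n}) := [set t : 'I_n * 'I_n | [&& t.1 != t.2, t.1 \in X & t.2 \in X]].
have -> : lam a = #|S (line i j) :|: S (line i k)|.
  have SE X s t : ((s, t) \in S X) = [&& s != t, s \in X & t \in X] by rewrite inE.
  apply: eq_card => -[s t]; rewrite in_setU !SE [LHS]inE /= -andb_orr.
  apply: andb_id2l => _.
  have [x [y [z es]]] := basisP (p s) hd; have [x' [y' [z' et]]] := basisP (p t) hd.
  rewrite (l1 _ _ _ _ es) (l2 _ _ _ _ es) (l1 _ _ _ _ et) (l2 _ _ _ _ et) /van es et !hzero.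
  rewrite pol_comb3 e1 e2 e3 e4 e5 e6 !mulr0 !add0r mulf_eq0 (negPf c0) orbF.
  rewrite -!rmorphM -rmorphD fmorph_eq0.
  have [->|z0] := eqVneq z 0; have [->|y0] := eqVneq y 0;
    rewrite ?mul0r ?mulr0 ?addr0 ?add0r ?eqxx /= ?mulf_eq0 ?(negPf z0) ?(negPf y0) ?orbF ?andbF
    ?orbF //=.
  + by case: (z' == 0); case: (y' == 0).
  + by case: (z' == 0); case: (y' == 0).
  + by case: (z' == 0); case: (y' == 0).
have -> : #|S (line i j) :|: S (line i k)| = (#|S (line i j)| + #|S (line i k)|)%N.
  rewrite cardsU disjoint_setI0 ?cards0 ?subn0 //.
  apply/pred0P => -[s t]; apply/negP; rewrite /= !inE /= -/(line i j).
  move=> /andP[/and3P[st s1 t1] /and3P[_ s2 t2]]; case/negP: st.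
  have : s \in line i j :&: line i k by rewrite in_setI !inE s1 s2.
  have : t \in line i j :&: line i k by rewrite in_setI !inE t1 t2.
  by rewrite hI !in_set1 => /eqP-> /eqP->.
by rewrite /S !card_offdiag !card_line //=; lia.
Qed.

Lemma type0 : lam 0 = (n * n.-1)%N /\ #|zeros 0| = n.
Proof.
have q0 v : qf 0 v = 0 by rewrite qfE !mxE !mul0r !addr0.
have hZ : zeros 0 = setT by apply/setP => i; rewrite !inE q0 eqxx.
rewrite hZ cardsT card_ord; split => //.
have := card_offdiag [set: 'I_n]; rewrite cardsT card_ord => <-.
apply: eq_card => -[i j]; rewrite !inE /=; congr (_ && _).
by apply/and3P; split; apply/eqP; rewrite /pol !q0 ?subr0.
Qed.

(** Every vector over F is a multiple of a point, and the values on these vectors determine the form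
    even over L. Hence distinct forms give distinct codewords. *)
Lemma zeros_all a : #|zeros a| = n -> a = 0.
Proof.
move=> h; apply: (@qf_eq0 _ _ iota) => v; have [->|] := eqVneq v 0.
  by rewrite qfE !coordE !rmorph0; ring.
case/pt_scale => i [c [_ ->]]; rewrite qfZ.
have : i \in zeros a.
  have -> : zeros a = setT by apply/eqP; rewrite eqEcard subsetT cardsT card_ord h leqnn.
  by rewrite inE.
by rewrite inE => /eqP->; rewrite mulr0.
Qed.

(** If the conic contains a line, the zeros off that line decide: two of them force a second line,
    or the zero form when the last coefficient vanishes; with at most one, no second line fits
    in. *)
Lemma classification a : (lam a, #|zeros a|) \in types.
Proof.
have [/existsP[i /existsP[j /andP[hij hv]]]|] := boolP [exists i, exists j, (i != j) && van a i
  j]; last first.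
  move=> h; have hv k l : k != l -> ~~ van a k l.
    by move=> kl; apply: contra h => hv; apply/existsP; exists k; apply/existsP; exists l;
      rewrite kl.
  rewrite lam_no_van // /types !inE.
  have [|->] := no_van_zeros hv; last by rewrite !addn1 !eqxx ?orbT.
  by case: #|_| => [|[|[|[|[|]]]]]; rewrite //= ?orbT.
have sub := van_zeros hij hv.
have hc : #|zeros a| = (q.+1 + #|zeros a :\: line i j|)%N.
  by rewrite -(card_line hij) -(cardsID (line i j) (zeros a)) (setIidPr sub).
have [h2|h2] := ltnP 1 #|zeros a :\: line i j|.
  have [k [l [hk hl hkl]]] := card_gt1P h2.
  move: hk hl; rewrite !in_setD => /andP[ok hk] /andP[ol hl].
  have [i' [j' [c [hd _ he]]]] := two_zeros_off_line hij hv hkl hk hl ok ol.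
  have [c0|c0] := eqVneq c 0; last first.
    by have [-> ->] := type_two_lines hd c0 he; rewrite /types !inE eqxx orbT.
  have -> : a = 0.
    apply: (coef_inj (iota := iota) hd) => /=; rewrite he c0 /coef /pol !qfE !mxE.
    by rewrite !mul0r !addr0 !subr0.
  by have [-> ->] := type0; rewrite inE eqxx.
have -> : lam a = (q.+1 * q)%N.
  apply: (lam_one_line hij hv) => k l hkl hv'.
  suff H k' l' : k' != l' -> van a k' l' -> k' \in line i j.
    by rewrite (H k l) // (H l k) // 1?eq_sym // van_sym.
  move=> hkl' hv2; apply: contraTT h2 => ok; rewrite -ltnNge.
  (* A second line meets the first in at most one point, so it would bring at least q zeros off the
     first line. *)
  have le1 : (#|line k' l' :&: line i j| <= 1)%N.
    apply/card_le1P => u hu t; rewrite [RHS]inE; move: hu; rewrite in_setI => /andP[u1 u2].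
    rewrite in_setI; apply/andP/eqP => [[t1 t2]|-> //].
    apply/eqP; apply: contraNT ok => ut.
    by rewrite -(line_sub hij ut t2 u2) (line_sub hkl' ut t1 u1) line_l.
  have : (#|line k' l' :\: line i j| <= #|zeros a :\: line i j|)%N.
    by apply: subset_leq_card; apply: setSD; apply: van_zeros.
  have := cardsID (line i j) (line k' l'); rewrite card_line //; move: hq; lia.
rewrite hc; move: h2; case: #|_| => [|[|]] // _; rewrite /types !inE.
  by rewrite addn0 !addn1 !eqxx ?orbT.
by rewrite addn1 addn2 !eqxx ?orbT.
Qed.
End Points.

(** * Double counting *)

Lemma double_count (A T : finType) (P : pred T) (R : A -> pred T) (f : A -> nat) c :
  (forall a, #|[set t | P t && R a t]| = f a) ->
  (forall t, P t -> #|[set a | R a t]| = c) ->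
  (\sum_a f a = #|[set t | P t]| * c)%N.
Proof.
move=> hf hc; transitivity (\sum_a \sum_(t | P t && R a t) 1)%N.
  by apply: eq_bigr => a _; rewrite sum1_card -hf; apply: eq_card => t; rewrite inE.
rewrite (exchange_big_dep P) /=; last by move=> a t _ /andP[].
rewrite -sum_nat_const; rewrite [RHS](eq_bigl P); last by move=> t; rewrite inE.
apply: eq_bigr => t ht; rewrite sum1_card -(hc t ht).
by apply: eq_card => a; rewrite !inE -topredE /= ht.
Qed.

Lemma card_dep_pairs (T1 T2 : finType) (S : pred T1) (S' : T1 -> pred T2) c :
  (forall t, S t -> #|[set u | S' t u]| = c) ->
  #|[set t : T1 * T2 | S t.1 && S' t.1 t.2]| = (#|[set t | S t]| * c)%N.
Proof.
move=> hc; rewrite -sum1_card.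
rewrite (eq_bigl (fun t : T1 * T2 => S t.1 && S' t.1 t.2)); last by move=> t; rewrite inE.
rewrite -(pair_big_dep S S' (fun _ _ => 1%N)) /= -sum_nat_const.
rewrite [RHS](eq_bigl S); last by move=> t; rewrite inE.
by apply: eq_bigr => t ht; rewrite sum1_card -(hc t ht); apply: eq_card => u; rewrite inE.
Qed.

Lemma card_prod_pred (T1 T2 : finType) (P1 : pred T1) (P2 : pred T2) :
  #|[set t : T1 * T2 | P1 t.1 && P2 t.2]| = (#|[set t | P1 t]| * #|[set t | P2 t]|)%N.
Proof. by apply: (@card_dep_pairs _ _ P1 (fun=> P2)). Qed.

(** * Counting coefficient vectors under linear conditions *)

Section CoefCounts.
Variables (L : finFieldType).
Notation Q := #|L|.
Local Notation L6 := (L * L * L * L * L * L)%type.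

Lemma card_is0 : #|[set x : L | pred1 0 x]| = 1%N.
Proof. by rewrite -(cards1 (0 : L)); apply: eq_card => x; rewrite !inE. Qed.

Lemma card_L6 (P1 P2 P3 P4 P5 P6 : pred L) :
  #|[set c : L6 | P1 c.1.1.1.1.1 && P2 c.1.1.1.1.2 && P3 c.1.1.1.2 && P4 c.1.1.2 && P5 c.1.2
     && P6 c.2]| =
  (#|[set c | P1 c]| * #|[set c | P2 c]| * #|[set c | P3 c]| * #|[set c | P4 c]|
    * #|[set c | P5 c]| * #|[set c | P6 c]|)%N.
Proof.
rewrite (card_prod_pred (fun c : L * L * L * L * L => P1 c.1.1.1.1 && P2 c.1.1.1.2 && P3
  c.1.1.2 && P4 c.1.2 && P5 c.2)).
rewrite (card_prod_pred (fun c : L * L * L * L => P1 c.1.1.1 && P2 c.1.1.2 && P3 c.1.2 && P4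
  c.2)).
rewrite (card_prod_pred (fun c : L * L * L => P1 c.1.1 && P2 c.1.2 && P3 c.2)).
by rewrite (card_prod_pred (fun c : L * L => P1 c.1 && P2 c.2)) card_prod_pred.
Qed.

Lemma card_lin2 (r s : L) : (r != 0) || (s != 0) ->
  #|[set c : L * L | r * c.1 + s * c.2 == 0]| = Q.
Proof.
have [s0|s0] := eqVneq s 0; last first.
  move=> _; rewrite -cardsT -(card_graph xpredT (fun x => - (r * x) / s)).
  apply: eq_card => -[x y]; rewrite !inE /=; apply/eqP/eqP => [h|->]; last by field.
  by apply: (mulfI s0); rewrite -[LHS]subr0 -h; field.
rewrite orbF => r0; rewrite -[RHS]mul1n -[X in (X * _)%N]card_is0 -[in RHS]cardsT.
rewrite -(card_prod_pred (pred1 (0 : L)) xpredT); apply: eq_card => -[x y].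
by rewrite !inE /= s0 mul0r addr0 mulf_eq0 (negPf r0) andbT.
Qed.

Lemma card_lin3 (r s t : L) : [|| r != 0, s != 0 | t != 0] ->
  #|[set c : L * L * L | r * c.1.1 + s * c.1.2 + t * c.2 == 0]| = (Q ^ 2)%N.
Proof.
have [t0|t0] := eqVneq t 0; last first.
  have -> : (Q ^ 2 = #|[set: L * L]|)%N by rewrite cardsT card_prod expnS expn1.
  move=> _; rewrite -(card_graph xpredT (fun x => - (r * x.1 + s * x.2) / t)).
  apply: eq_card => -[[x y] u]; rewrite !inE /=; apply/eqP/eqP => [h|->]; last by field.
  by apply: (mulfI t0); rewrite -[LHS]subr0 -h; field.
rewrite orbF => rs; rewrite expnS expn1 -{1}(card_lin2 rs) -[in RHS]cardsT.
rewrite -(card_prod_pred (fun c : L * L => r * c.1 + s * c.2 == 0) xpredT).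
by apply: eq_card => -[x y]; rewrite !inE /= t0 mul0r addr0 andbT.
Qed.
End CoefCounts.

(** * Forms through given configurations, and the resulting moments *)

Section Counting.
Variables (F : finFieldType) (q n : nat) (p : 'I_n -> 'rV[F]_3).
Hypotheses (hF : #|F| = q) (hn : n = (q ^ 2 + q + 1)%N) (hp : proj_representatives p).
Hypothesis hq : (4 <= q)%N.
Variables (L : finFieldType) (iota : {rmorphism F -> L}).
Implicit Types (i j k l : 'I_n) (a : 'rV[L]_6).
Local Notation qf := (qf iota).
Local Notation pol := (pol iota).
Local Notation coef := (coef iota).
Local Notation Q := #|L|.
Local Notation zeros := (zeros p iota).
Local Notation van := (van p iota).
Local Notation lam := (lam p iota).
Local Notation line := (line p).
Local Notation z a := #|zeros a|.

Lemma exists_neq i : exists j, i != j.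
Proof.
have : (0 < #|[set~ i]|)%N by rewrite cardsC1 card_ord hn; move: hq; lia.
by case/card_gt0P => j; rewrite !inE eq_sym; exists j.
Qed.

Lemma card_forms_coef i j k (R : pred (L * L * L * L * L * L)) (S : pred 'rV[L]_6) :
  k \notin line i j -> (forall a, S a = R (coef a (p i) (p j) (p k))) ->
  #|[set a | S a]| = #|[set c | R c]|.
Proof.
rewrite -det3_line => hd h; rewrite -(card_coef iota R hd); apply: eq_card => a.
by rewrite !inE h.
Qed.

(** The slots follow [coef]: the values at [i], [j], [k], then the polar values on [i j], [i k],
    [j k]. A slot is forced to zero by [o] and left free by [xpredT]. *)
Local Notation c6 P1 P2 P3 P4 P5 P6 := (fun c : L * L * L * L * L * L =>
  P1 c.1.1.1.1.1 && P2 c.1.1.1.1.2 && P3 c.1.1.1.2 && P4 c.1.1.2 && P5 c.1.2 && P6 c.2).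
Local Notation o := (pred1 (0 : L)).

Lemma off_line i j : i != j -> exists k, k \notin line i j.
Proof. by case/(pt_third hp) => k; rewrite det3_line; exists k. Qed.

Lemma forms_pt i : #|[set a | i \in zeros a]| = (Q ^ 5)%N.
Proof.
have [j ij] := exists_neq i; have [k hk] := off_line ij.
rewrite (card_forms_coef (R := c6 o xpredT xpredT xpredT xpredT xpredT) hk).
  by rewrite (card_L6 o xpredT xpredT xpredT xpredT xpredT) card_is0 !cardsT; ring.
by move=> a; rewrite inE /= !andbT.
Qed.

Lemma forms_pt2 i j : i != j -> #|[set a | (i \in zeros a) && (j \in zeros a)]| = (Q ^ 4)%N.
Proof.
move=> ij; have [k hk] := off_line ij.
rewrite (card_forms_coef (R := c6 o o xpredT xpredT xpredT xpredT) hk).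
  by rewrite (card_L6 o o xpredT xpredT xpredT xpredT) card_is0 !cardsT; ring.
by move=> a; rewrite !inE /= !andbT.
Qed.

Lemma forms_van i j : i != j -> #|[set a | van a i j]| = (Q ^ 3)%N.
Proof.
move=> ij; have [k hk] := off_line ij.
rewrite (card_forms_coef (R := c6 o o xpredT o xpredT xpredT) hk).
  by rewrite (card_L6 o o xpredT o xpredT xpredT) card_is0 !cardsT; ring.
by move=> a; rewrite /van /= !andbT andbA.
Qed.

Lemma van_three a i j k : i != j -> k != i -> k != j -> k \in line i j ->
  [&& i \in zeros a, j \in zeros a & k \in zeros a] = van a i j.
Proof.
move=> ij ki kj hk; apply/and3P/idP => [[hi hj hk']|hv].
  exact: (three_zeros hp) hk _ _ hi hj hk'.
by have /subsetP sub := van_zeros hp ij hv; split; apply: sub; rewrite ?line_l ?line_r.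
Qed.

(** Three points impose three independent conditions in either position: if collinear they amount to
    containing their line, otherwise they form a frame. *)
Lemma forms_pt3 i j k : i != j -> k != i -> k != j ->
  #|[set a | [&& i \in zeros a, j \in zeros a & k \in zeros a]]| = (Q ^ 3)%N.
Proof.
move=> ij ki kj; have [hk|hk] := boolP (k \in line i j).
  by rewrite -(forms_van ij); apply: eq_card => a; rewrite !inE -(van_three _ ij ki kj hk) !inE.
rewrite (card_forms_coef (R := c6 o o o xpredT xpredT xpredT) hk).
  by rewrite (card_L6 o o o xpredT xpredT xpredT) card_is0 !cardsT; ring.
by move=> a; rewrite !inE /= !andbT andbA.
Qed.

Lemma forms_van_pt i j k : k \notin line i j ->
  #|[set a | van a i j && (k \in zeros a)]| = (Q ^ 2)%N.
Proof.
move=> hk; rewrite (card_forms_coef (R := c6 o o o o xpredT xpredT) hk).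
  by rewrite (card_L6 o o o o xpredT xpredT) card_is0 !cardsT; ring.
move=> a; rewrite !inE /= !andbT /van.
by case: (qf a (p i) == 0); case: (qf a (p j) == 0); rewrite //= andbC.
Qed.

(** A point outside the frame couples the three polar values, so these need a joint condition
    instead of slotwise ones. *)
Lemma card_mixed (P1 P2 P3 : pred L) (P : pred (L * L * L)) :
  #|[set c : L * L * L * L * L * L | [&& P1 c.1.1.1.1.1, P2 c.1.1.1.1.2, P3 c.1.1.1.2 &
       P (c.1.1.2, c.1.2, c.2)]]| =
  (#|[set c | P1 c]| * #|[set c | P2 c]| * #|[set c | P3 c]| * #|[set c | P c]|)%N.
Proof.
rewrite -!mulnA -3!card_prod_pred.
pose f (t : L * (L * (L * (L * L * L)))) : L * L * L * L * L * L :=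
  (t.1, t.2.1, t.2.2.1, t.2.2.2.1.1, t.2.2.2.1.2, t.2.2.2.2).
have fi : injective f by move=> [? [? [? [[? ?] ?]]]] [? [? [? [[? ?] ?]]]] [-> -> -> -> -> ->].
rewrite -(card_imset _ fi); apply: eq_card => -[[[[[c1 c2] c3] c4] c5] c6]; rewrite !inE /=.
apply/idP/imsetP => [h|[t]]; first by exists (c1, (c2, (c3, ((c4, c5), c6)))); rewrite ?inE.
by rewrite inE => ht [-> -> -> -> -> ->]; move: ht; case: t => [? [? [? [[? ?] ?]]]].
Qed.

(** In the frame [i], [j], [k] only the polar values on [i k] and [j k] remain free, and [l] imposes
    one linear equation on them. It is nontrivial because [l] is off the line and different from
    [k]. *)
Lemma forms_van_pt2 i j k l : i != j -> k \notin line i j -> l \notin line i j -> k != l ->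
  #|[set a | [&& van a i j, k \in zeros a & l \in zeros a]]| = Q.
Proof.
move=> ij hk hl kl; move: (hk); rewrite -det3_line => hd.
have [x [y [w e]]] := basisP (p l) hd.
have w0 : w != 0.
  by move: hl; rewrite -det3_line e det3_comb_last; apply: contraNneq => ->; rewrite mul0r.
have xy : (x != 0) || (y != 0).
  apply: contraNT kl; rewrite negb_or !negbK => /andP[/eqP x0 /eqP y0].
  by apply/eqP/(pt_inj hp (c := w)); rewrite e x0 y0 /comb3 !scale0r !add0r.
have xy' : (iota x * iota w != 0) || (iota y * iota w != 0).
  by rewrite !mulf_eq0 !fmorph_eq0 (negPf w0) !orbF.
pose P (t : L * L * L) :=
  (t.1.1 == 0) && ((iota x * iota w) * t.1.2 + (iota y * iota w) * t.2 == 0).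
rewrite (card_forms_coef (R := fun c => [&& o c.1.1.1.1.1, o c.1.1.1.1.2, o c.1.1.1.2 &
   P (c.1.1.2, c.1.2, c.2)]) hk).
  rewrite (card_mixed o o o P) !card_is0 !mul1n -[RHS]mul1n -(card_lin2 xy').
  rewrite -[X in (X * _)%N](card_is0 L) -(card_prod_pred o (fun c : L * L => _ * c.1 + _ * c.2
    == 0)).
  pose f (t : L * (L * L)) : L * L * L := (t.1, t.2.1, t.2.2).
  have fi : injective f by move=> [? [? ?]] [? [? ?]] [-> -> ->].
  rewrite -(card_imset _ fi); apply: eq_card => -[[c1 c2] c3]; rewrite !inE /=.
  apply/idP/imsetP => [h|[t]]; first by exists (c1, (c2, c3)); rewrite ?inE.
  by rewrite inE => ht [-> -> ->].
move=> a; rewrite !inE /= /van /P /= e qf_comb3.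
have [->|] := eqVneq (qf a (p i)) 0; last by [].
have [->|] := eqVneq (qf a (p j)) 0; last by [].
have [->|] := eqVneq (qf a (p k)) 0; last by rewrite andbF.
have [->|] := eqVneq (pol a (p i) (p j)) 0; last by [].
by rewrite !mulr0 !add0r.
Qed.

(** Four collinear points impose only three conditions, those of their line; any other four impose
    four. If exactly one of [k], [l] is on the line [i j], the conditions are that line and a point
    off it; if neither is, [l] gives one equation on the polar values in the frame [i], [j], [k]. *)
Lemma forms_pt4 i j k l : i != j -> k != i -> k != j -> l != i -> l != j -> k != l ->
  #|[set a | [&& i \in zeros a, j \in zeros a, k \in zeros a & l \in zeros a]]|
  = if (k \in line i j) && (l \in line i j) then (Q ^ 3)%N else (Q ^ 2)%N.
Proof.
move=> ij ki kj li lj kl.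
have side s t : s != i -> s != j -> s \in line i j -> t \notin line i j ->
   #|[set a | [&& i \in zeros a, j \in zeros a, s \in zeros a & t \in zeros a]]| = (Q ^ 2)%N.
  move=> si sj hs ht; rewrite -(forms_van_pt ht); apply: eq_card => a; rewrite [LHS]inE [RHS]inE.
  by rewrite -(van_three a ij si sj hs) -!andbA.
have [hk|hk] := boolP (k \in line i j); have [hl|hl] := boolP (l \in line i j) => /=.
- rewrite -(forms_van ij); apply: eq_card => a; rewrite [LHS]inE [RHS]inE.
  apply/and4P/idP => [[h1 h2 h3 h4]|hv].
    by rewrite -(van_three a ij ki kj hk) h1 h2 h3.
  by have /subsetP sub := van_zeros hp ij hv; split; apply: sub; rewrite ?line_l ?line_r.
- exact: side.
- rewrite -(side l k) //; apply: eq_card => a; rewrite [LHS]inE [RHS]inE.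
  by do 2!congr (_ && _); rewrite andbC.
move: (hk); rewrite -det3_line => hd.
have [x [y [w e]]] := basisP (p l) hd.
have w0 : w != 0.
  by move: hl; rewrite -det3_line e det3_comb_last; apply: contraNneq => ->; rewrite mul0r.
have xy : (x != 0) || (y != 0).
  apply: contraNT kl; rewrite negb_or !negbK => /andP[/eqP x0 /eqP y0].
  by apply/eqP/(pt_inj hp (c := w)); rewrite e x0 y0 /comb3 !scale0r !add0r.
(* One of [x] and [y] may vanish, when [l] is collinear with [k] and one of [i], [j]; the equation
   stays nontrivial. *)
have xy' : [|| iota x * iota y != 0, iota x * iota w != 0 | iota y * iota w != 0].
  by rewrite !mulf_eq0 !fmorph_eq0 (negPf w0) !orbF xy orbT.
pose P (t : L * L * L) :=
  (iota x * iota y) * t.1.1 + (iota x * iota w) * t.1.2 + (iota y * iota w) * t.2 == 0.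
rewrite (card_forms_coef (R := fun c => [&& o c.1.1.1.1.1, o c.1.1.1.1.2, o c.1.1.1.2 &
   P (c.1.1.2, c.1.2, c.2)]) hk).
  by rewrite (card_mixed o o o P) !card_is0 !mul1n card_lin3.
move=> a; rewrite !inE /= e qf_comb3.
have [->|] := eqVneq (qf a (p i)) 0; last by [].
have [->|] := eqVneq (qf a (p j)) 0; last by [].
have [->|] := eqVneq (qf a (p k)) 0; last by [].
by rewrite !mulr0 !add0r.
Qed.

Lemma card_minus2 (Z : {set 'I_n}) i j : i != j -> i \in Z -> j \in Z ->
  #|[set k | [&& k != i, k != j & k \in Z]]| = (#|Z| - 2)%N.
Proof.
move=> ij hi hj; rewrite (cardsD1 i Z) hi (cardsD1 j (Z :\ i)) !inE eq_sym ij hj /= addnA addKn.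
by apply: eq_card => k; rewrite !inE andbCA.
Qed.

Lemma card_pairs_pred (Z : {set 'I_n}) (S : pred 'I_n) : S =1 mem Z ->
  #|[set t : 'I_n * 'I_n | [&& t.1 != t.2, S t.1 & S t.2]]| = (#|Z| * #|Z|.-1)%N.
Proof. by move=> h; rewrite -card_offdiag; apply: eq_card => t; rewrite !inE !h. Qed.

Lemma card_distinct_pairs : #|[set t : 'I_n * 'I_n | t.1 != t.2]| = (n * n.-1)%N.
Proof.
have := card_pairs_pred (Z := setT) (S := xpredT); rewrite cardsT card_ord => <-.
  by apply: eq_card => t; rewrite !inE !andbT.
by move=> x; exact: (esym (in_setT x)).
Qed.

Lemma moment1 : (\sum_a z a = n * Q ^ 5)%N.
Proof.
have -> : (n * Q ^ 5 = #|[set i : 'I_n | xpredT i]| * Q ^ 5)%N.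
  by congr (_ * _)%N; rewrite -[LHS]card_ord -cardsT; apply: eq_card => i; rewrite !inE.
apply: (double_count (R := fun a i => i \in zeros a)) => [a|i _]; last exact: forms_pt.
by apply: eq_card => i; rewrite inE.
Qed.

Lemma moment2 : (\sum_a z a * (z a).-1 = n * n.-1 * Q ^ 4)%N.
Proof.
rewrite -card_distinct_pairs.
apply: (double_count (P := fun t : 'I_n * 'I_n => t.1 != t.2)
  (R := fun a t => (t.1 \in zeros a) && (t.2 \in zeros a))) => [a|t ht]; last exact: forms_pt2.
by apply: (card_pairs_pred (S := fun i => i \in zeros a)) => x.
Qed.

Lemma card_triples a (S : 'I_n * 'I_n -> pred 'I_n) c :
  (forall t, [&& t.1 != t.2, t.1 \in zeros a & t.2 \in zeros a] -> #|[set k | S t k]| = c) ->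
  #|[set t : ('I_n * 'I_n) * 'I_n |
     [&& t.1.1 != t.1.2, t.1.1 \in zeros a & t.1.2 \in zeros a] && S t.1 t.2]|
  = (z a * (z a).-1 * c)%N.
Proof.
move=> h; rewrite (@card_dep_pairs _ _ (fun t : 'I_n * 'I_n => [&& t.1 != t.2, t.1 \in zeros a
  & t.2 \in zeros a]) S c) //.
by congr (_ * _)%N; apply: (card_pairs_pred (S := fun i => i \in zeros a)) => x.
Qed.

Lemma moment3 : (\sum_a z a * (z a).-1 * (z a - 2) = n * n.-1 * (n - 2) * Q ^ 3)%N.
Proof.
have -> : (n * n.-1 * (n - 2) = #|[set t : ('I_n * 'I_n) * 'I_n |
    (t.1.1 != t.1.2) && (t.2 != t.1.1) && (t.2 != t.1.2)]|)%N.
  rewrite -card_distinct_pairs.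
  rewrite -(@card_dep_pairs _ _ (fun t : 'I_n * 'I_n => t.1 != t.2) (fun t k => (k != t.1) &&
    (k != t.2))).
    by apply: eq_card => t; rewrite !inE andbA.
  move=> t ht; have -> : (n - 2 = #|[set: 'I_n]| - 2)%N by rewrite cardsT card_ord.
  rewrite -(card_minus2 ht) ?inE //.
  by apply: eq_card => k; rewrite !inE !andbT.
apply: (double_count (R := fun a t => [&& t.1.1 \in zeros a, t.1.2 \in zeros a & t.2 \in zeros
  a])) => [a|t].
  rewrite -(card_triples (S := fun t k => [&& k != t.1, k != t.2 & k \in zeros a])).
    apply: eq_card => t; rewrite [LHS]inE [RHS]inE.
    by case: (t.1.1 != _); case: (t.2 != _); case: (t.2 != _); case: (_ \in _); case: (_ \in _).
  by move=> t /and3P[h1 h2 h3]; rewrite card_minus2.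
by move=> /andP[/andP[h1 h2] h3]; apply: forms_pt3.
Qed.

Lemma sum_lam_zeros (f : 'rV[L]_6 -> 'I_n * 'I_n -> pred 'I_n) c :
  (forall a t, t.1 != t.2 -> van a t.1 t.2 -> #|[set k | f a t k]| = c a) ->
  forall a, #|[set t : ('I_n * 'I_n) * 'I_n | (t.1.1 != t.1.2) && van a t.1.1 t.1.2 && f a t.1
    t.2]|
    = (lam a * c a)%N.
Proof.
move=> h a; rewrite (@card_dep_pairs _ _ (fun t => (t.1 != t.2) && van a t.1 t.2) (f a) (c a)) //.
by move=> t /andP[]; apply: h.
Qed.

Lemma van_moment1 : (\sum_a lam a = n * n.-1 * Q ^ 3)%N.
Proof.
rewrite -card_distinct_pairs.
by apply: (double_count (P := fun t : 'I_n * 'I_n => t.1 != t.2) (R := fun a t => van a t.1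
  t.2)) => // t; apply: forms_van.
Qed.

Lemma card_off_line (Z : {set 'I_n}) i j : i != j -> line i j \subset Z ->
  #|[set k | (k \notin line i j) && (k \in Z)]| = (#|Z| - q.+1)%N.
Proof.
move=> ij sub; rewrite -(card_line hF hn hp ij) -(cardsID (line i j) Z) (setIidPr sub) addKn.
by apply: eq_card => k; rewrite [LHS]inE [RHS]in_setD.
Qed.

(** Once a line of the conic is fixed, [z a - q.+1] is the number of zeros off it, so the sum counts
    forms with a line in the conic and a zero off that line. *)
Lemma van_moment2 : (\sum_a lam a * (z a - q.+1) = n * n.-1 * (n - q.+1) * Q ^ 2)%N.
Proof.
have -> : (n * n.-1 * (n - q.+1) = #|[set t : ('I_n * 'I_n) * 'I_n |
    (t.1.1 != t.1.2) && (t.2 \notin line t.1.1 t.1.2)]|)%N.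
  rewrite -card_distinct_pairs.
  rewrite (@card_dep_pairs _ _ (fun t : 'I_n * 'I_n => t.1 != t.2) (fun t k => k \notin line
    t.1 t.2) (n - q.+1)%N) //.
  move=> t ht; have -> : (n - q.+1 = #|[set: 'I_n]| - q.+1)%N by rewrite cardsT card_ord.
  rewrite -(card_off_line ht (subsetT _)).
  by apply: eq_card => k; rewrite [LHS]inE [RHS]inE in_setT andbT.
apply: (double_count (R := fun a t => van a t.1.1 t.1.2 && (t.2 \in zeros a))) => [a|t].
  rewrite -(sum_lam_zeros (f := fun a t k => (k \notin line t.1 t.2) && (k \in zeros a)) (c :=
    fun a => (z a - q.+1)%N)).
    apply: eq_card => t; rewrite [LHS]inE [RHS]inE.
    by case: (t.1.1 != _); case: (van _ _ _); case: (t.2 \in line _ _); case: (t.2 \in zeros a).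
  by move=> b t h1 h2; rewrite card_off_line // van_zeros.
by move=> /andP[h1 h2]; apply: forms_van_pt.
Qed.

Lemma card_quads (P1 : pred ('I_n * 'I_n)) (S : 'I_n * 'I_n -> {set 'I_n}) m :
  (forall t, P1 t -> #|S t| = m) ->
  #|[set t : ('I_n * 'I_n) * ('I_n * 'I_n) |
     P1 t.1 && [&& t.2.1 != t.2.2, t.2.1 \in S t.1 & t.2.2 \in S t.1]]|
  = (#|[set t | P1 t]| * (m * m.-1))%N.
Proof.
move=> h; rewrite (@card_dep_pairs _ _ P1 (fun t u => [&& u.1 != u.2, u.1 \in S t & u.2 \in S
  t]) (m * m.-1)) //.
by move=> t /h <-; rewrite -card_offdiag.
Qed.

Lemma van_moment3 : (\sum_a lam a * ((z a - q.+1) * (z a - q.+1).-1) =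
  n * n.-1 * ((n - q.+1) * (n - q.+1).-1) * Q)%N.
Proof.
pose S (Z : {set 'I_n}) (t : 'I_n * 'I_n) := [set k | (k \notin line t.1 t.2) && (k \in Z)].
have SE Z t k : (k \in S Z t) = (k \notin line t.1 t.2) && (k \in Z) by rewrite [LHS]inE.
have ST t k : (k \in S setT t) = (k \notin line t.1 t.2) by rewrite SE in_setT andbT.
have -> : (n * n.-1 * ((n - q.+1) * (n - q.+1).-1) = #|[set t : ('I_n * 'I_n) * ('I_n * 'I_n) |
    (t.1.1 != t.1.2) && [&& t.2.1 != t.2.2, t.2.1 \in S setT t.1 & t.2.2 \in S setT t.1]]|)%N.
  rewrite -card_distinct_pairs.
  rewrite (card_quads (P1 := fun t => t.1 != t.2) (m := (n - q.+1)%N)) // => t ht.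
  by rewrite card_off_line ?subsetT // cardsT card_ord.
apply: (double_count (R := fun a t => [&& van a t.1.1 t.1.2, t.2.1 \in zeros a & t.2.2 \in
  zeros a])) => [a|t].
  rewrite -(card_quads (P1 := fun t => (t.1 != t.2) && van a t.1 t.2) (S := S (zeros a))).
    apply: eq_card => t; rewrite [LHS]inE [RHS]inE !ST !SE.
    case: (t.1.1 != _); case: (van _ _ _); case: (t.2.1 != _); case: (t.2.1 \in zeros a);
    case: (t.2.1 \in line _ _); case: (t.2.2 \in line _ _);
    by case: (t.2.2 \in zeros a); rewrite ?andbF ?andbT.
  by move=> t /andP[h1 h2]; rewrite card_off_line // van_zeros.
case/and4P => h1 h2; rewrite !ST => h3 h4.
exact: forms_van_pt2.
Qed.

(** Every ordered quadruple of distinct points contributes Q^2, except the n (n - 1) (q - 1) (q - 2)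
    collinear ones, which contribute Q^3. The correction stands on the left to avoid a subtraction
    of natural numbers. *)
Lemma moment4 : (\sum_a z a * (z a).-1 * ((z a - 2) * (z a - 2).-1)
    + n * n.-1 * (q.-1 * q.-2) * Q ^ 2 =
  n * n.-1 * ((n - 2) * (n - 2).-1) * Q ^ 2 + n * n.-1 * (q.-1 * q.-2) * Q ^ 3)%N.
Proof.
pose S (Z : {set 'I_n}) (t : 'I_n * 'I_n) := [set k | [&& k != t.1, k != t.2 & k \in Z]].
have SE Z t k : (k \in S Z t) = [&& k != t.1, k != t.2 & k \in Z] by rewrite [LHS]inE.
have ST t k : (k \in S setT t) = (k != t.1) && (k != t.2) by rewrite SE in_setT andbT.
pose P0 (t : ('I_n * 'I_n) * ('I_n * 'I_n)) :=
    (t.1.1 != t.1.2) && [&& t.2.1 != t.2.2, t.2.1 \in S setT t.1 & t.2.2 \in S setT t.1].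
pose C0 (t : ('I_n * 'I_n) * ('I_n * 'I_n)) :=
   (t.2.1 \in line t.1.1 t.1.2) && (t.2.2 \in line t.1.1 t.1.2).
have -> : (n * n.-1 * ((n - 2) * (n - 2).-1) = #|[set t | P0 t]|)%N.
  rewrite -card_distinct_pairs.
  rewrite (card_quads (P1 := fun t => t.1 != t.2) (m := (n - 2)%N)) // => t ht.
  by rewrite card_minus2 ?inE // cardsT card_ord.
have -> : (n * n.-1 * (q.-1 * q.-2) = #|[set t | P0 t && C0 t]|)%N.
  rewrite -card_distinct_pairs.
  rewrite -(card_quads (P1 := fun t => t.1 != t.2) (S := fun t => S (line t.1 t.2) t)).
    apply: eq_card => t; rewrite [LHS]inE [RHS]inE /P0 /C0 !ST !SE.
    case: (t.1.1 != _); case: (t.2.1 != _); case: (t.2.1 \in line _ _);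
    case: (t.2.1 != _); case: (t.2.1 != _); case: (t.2.2 != _); case: (t.2.2 != _);
    by case: (t.2.2 \in line _ _); rewrite ?andbF ?andbT.
  move=> t ht; rewrite card_minus2 ?line_l ?line_r // (card_line hF hn hp ht).
  by rewrite subSS subn1.
have -> : (\sum_a z a * (z a).-1 * ((z a - 2) * (z a - 2).-1) =
    #|[set t | P0 t && C0 t]| * Q ^ 3 + #|[set t | P0 t && ~~ C0 t]| * Q ^ 2)%N.
  pose R a (t : ('I_n * 'I_n) * ('I_n * 'I_n)) :=
    [&& t.1.1 \in zeros a, t.1.2 \in zeros a, t.2.1 \in zeros a & t.2.2 \in zeros a].
  rewrite -(double_count (R := R) (P := fun t => P0 t && C0 t) (f := fun a => #|[set t | P0 t
    && C0 t && R a t]|)) //; last first.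
    move=> t /andP[/and4P[h1 h2]]; rewrite !ST.
    by move=> /andP[h3 h4] /andP[h5 h6] hC; rewrite /R forms_pt4 // -/(C0 t) hC.
  rewrite -(double_count (R := R) (P := fun t => P0 t && ~~ C0 t) (f := fun a => #|[set t | P0
    t && ~~ C0 t && R a t]|)) //; last first.
    move=> t /andP[/and4P[h1 h2]]; rewrite !ST.
    by move=> /andP[h3 h4] /andP[h5 h6] hC; rewrite /R forms_pt4 // -/(C0 t) (negPf hC).
  rewrite -big_split /=; apply: eq_bigr => a _.
  transitivity #|[set t | P0 t && R a t]|; last first.
    rewrite -(cardsID [set t | C0 t] [set t | P0 t && R a t]); congr addn.
      by apply: eq_card => t; rewrite in_setI !in_set andbAC.
    by apply: eq_card => t; rewrite in_setD !in_set; case: (P0 t); case: (C0 t); case: (R a t).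
  have <- : #|[set t : 'I_n * 'I_n | [&& t.1 != t.2, t.1 \in zeros a & t.2 \in zeros a]]| = (z
    a * (z a).-1)%N.
    exact: card_offdiag.
  rewrite -(card_quads (P1 := fun t => [&& t.1 != t.2, t.1 \in zeros a & t.2 \in zeros a]) (S
    := S (zeros a))).
    apply: eq_card => t; rewrite [LHS]inE [RHS]inE /P0 /R !ST !SE.
    case: (t.1.1 != _); case: (t.2.1 != _); case: (t.2.1 \in zeros a); case: (t.2.2 \in zeros a);
    case: (t.2.1 != _); case: (t.2.1 != _); case: (t.2.2 != _); case: (t.2.2 != _);
    case: (t.1.1 \in zeros a); case: (t.1.2 \in zeros a); by rewrite ?andbF ?andbT.
  by move=> t /and3P[h1 h2 h3]; rewrite card_minus2.
have -> : #|[set t | P0 t]| = (#|[set t | P0 t && C0 t]| + #|[set t | P0 t && ~~ C0 t]|)%N.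
  rewrite -(cardsID [set t | C0 t] [set t | P0 t]); congr addn.
    by apply: eq_card => t; rewrite in_setI !in_set.
  by apply: eq_card => t; rewrite in_setD !in_set andbC.
lia.
Qed.

End Counting.

(** * The number of smooth conics *)

Section Smooth.
Variables (F : finFieldType) (q n : nat) (p : 'I_n -> 'rV[F]_3).
Hypotheses (hF : #|F| = q) (hn : n = (q ^ 2 + q + 1)%N) (hp : proj_representatives p).
Hypothesis hq : (4 <= q)%N.
Variables (L : finFieldType) (iota : {rmorphism F -> L}).
Implicit Types (i j k l : 'I_n) (a : 'rV[L]_6).
Local Notation qf := (qf iota).
Local Notation pol := (pol iota).
Local Notation coef := (coef iota).
Local Notation Q := #|L|.
Local Notation zeros := (zeros p iota).
Local Notation van := (van p iota).
Local Notation lam := (lam p iota).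
Local Notation line := (line p).
Local Notation z a := #|zeros a|.

(** These forms are exactly those with coefficients (0, 0, 0, b, b x, b y), where b is a unit of L
    and x, y are units of F, and the parameters are unique. That every such conic is of this shape
    is [five_zeros], applied to the frame and two further zeros. *)
Lemma forms_smooth i j k : k \notin line i j ->
  #|[set a | [&& i \in zeros a, j \in zeros a, k \in zeros a, lam a == 0%N & z a == q.+1]]|
  = (Q.-1 * (q.-1 * q.-1))%N.
Proof.
move=> hk; move: (hk); rewrite -det3_line => hd.
pose B := [set t : L * (F * F) | (t.1 != 0) && ((t.2.1 != 0) && (t.2.2 != 0))].
have cB : #|B| = (Q.-1 * (q.-1 * q.-1))%N.
  have nz (K : finFieldType) : #|[set x : K | x != 0]| = #|K|.-1.
    by rewrite -(cardsC1 (0 : K)); apply: eq_card => x; rewrite !inE.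
  rewrite /B (card_prod_pred (fun x : L => x != 0) (fun u : F * F => (u.1 != 0) && (u.2 != 0))).
  by rewrite (card_prod_pred (fun x : F => x != 0) (fun x : F => x != 0)) !nz hF.
rewrite -cB -(card_in_imset (D := mem B) (f := fun t => ((0, 0, 0, t.1, t.1 * iota t.2.1, t.1 *
  iota t.2.2) : L * L * L * L * L * L))); last first.
  move=> [b [x y]] [b' [x' y']]; rewrite !inE /= => /andP[b0 _] _ [<-].
  by move=> /(mulfI b0)/fmorph_inj-> /(mulfI b0)/fmorph_inj->.
have [g gK Kg] : bijective (fun a => coef a (p i) (p j) (p k)).
  apply: inj_card_bij (coef_inj (iota := iota) hd) _.
  by rewrite card_mx !card_prod mul1n !expnS expn0 muln1 !mulnA.
rewrite -(card_imset _ (coef_inj (iota := iota) hd)); apply: eq_card => c.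
apply/imsetP/imsetP => [[a]|[[b [x y]]]]; last first.
  rewrite inE /= => /and3P[b0 x0 y0] ec; exists (g c); rewrite ?Kg //.
  move: (g c) (Kg c) => a /=; rewrite ec => ecoef.
  have hz : z a = q.+1.
    by apply: (card_smooth_zeros hF hn hp hd (a := a)); exists b, x, y; split => //;
      rewrite ecoef.
  case: (ecoef) => e1 e2 e3 _ _ _.
  have [h1 h2 h3] : [/\ i \in zeros a, j \in zeros a & k \in zeros a].
    by rewrite !inE e1 e2 e3 eqxx.
  rewrite in_set h1 h2 h3 hz eqxx andbT /=; apply/eqP/lam_no_van => s t st.
  (* A line in the conic has as many points as the conic, hence would contain [i], [j] and [k]. *)
  apply: contra hk => hv; have sub := van_zeros hp st hv.
  have eZ : line s t = zeros a.
    by apply/eqP; rewrite eqEcard sub (card_line hF hn hp st) hz leqnn.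
  by rewrite (line_sub hF hn hp st) ?eZ //; have [] := line_det_neq hd.
rewrite in_set => /and5P[h1 h2 h3 /eqP l0 /eqP hz] ec.
have hv s t : s != t -> ~~ van a s t.
  move=> st; apply/negP => hv; move: l0 => /eqP; rewrite cards_eq0 => /eqP/setP/(_ (s, t)).
  by rewrite !inE /= st -/(van a s t) hv.
have [ij ik jk] := line_det_neq hd.
have h2' : (1 < #|zeros a :\ i :\ j :\ k|)%N.
  move: hz; rewrite (cardsD1 i) h1 (cardsD1 j (_ :\ i)) in_setD1 h2 eq_sym ij.
  rewrite (cardsD1 k (_ :\ j)) !in_setD1 h3 eq_sym jk eq_sym ik /=; move: hq; lia.
have [l [m [hl hm lm]]] := card_gt1P h2'.
move: hl hm; rewrite !in_setD1 => /and4P[lk lj li hl] /and4P[mk mj mi hm].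
have [||_ [b [x [y [b0 x0 y0 e]]]]] := five_zeros hp (a := a) (i := i) (j := j) (k := k) (l :=
  l) (m := m) hv.
- by rewrite /= !inE !negb_or ij ik jk lm !(eq_sym _ l) !(eq_sym _ m) li lj lk mi mj mk.
- by move=> u; rewrite !in_cons in_nil => /or3P[/eqP->|/eqP->|/or4P[/eqP->|/eqP->|/eqP->|]].
by exists (b, (x, y)); rewrite ?inE /= ?b0 ?x0 ?y0 // ec e.
Qed.

(** Pairs of such a conic and an ordered triple of noncollinear points on it are counted twice. No
    three zeros are collinear, so each conic has (q + 1) q (q - 1) such triples. *)
Lemma smooth_count :
  (#|[set a | (lam a == 0%N) && (z a == q.+1)]| * (q.+1 * q * q.-1) =
   n * n.-1 * (n - q.+1) * (Q.-1 * (q.-1 * q.-1)))%N.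
Proof.
have -> : (n * n.-1 * (n - q.+1) = #|[set t : ('I_n * 'I_n) * 'I_n |
    (t.1.1 != t.1.2) && (t.2 \notin line t.1.1 t.1.2)]|)%N.
  rewrite -card_distinct_pairs.
  rewrite (@card_dep_pairs _ _ (fun t : 'I_n * 'I_n => t.1 != t.2) (fun t k => k \notin line
    t.1 t.2) (n - q.+1)%N) //.
  move=> t ht; have -> : (n - q.+1 = #|[set: 'I_n]| - q.+1)%N by rewrite cardsT card_ord.
  rewrite -(card_off_line hF hn hp ht (subsetT _)).
  by apply: eq_card => k; rewrite [LHS]inE [RHS]inE in_setT andbT.
rewrite -sum_nat_const big_mkcond /=.
apply: (double_count (R := fun a t => [&& t.1.1 \in zeros a, t.1.2 \in zeros a, t.2 \in zeros
  a, lam a == 0%N & z a == q.+1])) => [a|t /andP[_]]; last exact: forms_smooth.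
rewrite in_set; case: ifP => [/andP[/eqP l0 /eqP hz]|h]; last first.
  apply/eqP; rewrite cards_eq0; apply/eqP/setP => t; rewrite [RHS]inE [LHS]inE.
  by rewrite !andbF.
have hv s t : s != t -> ~~ van a s t.
  move=> st; apply/negP => hv; move: l0 => /eqP; rewrite cards_eq0 => /eqP/setP/(_ (s, t)).
  by rewrite !inE /= st -/(van a s t) hv.
have -> : (q.+1 * q * q.-1 = z a * (z a).-1 * q.-1)%N by rewrite hz.
rewrite -(card_triples (S := fun t k => [&& k != t.1, k != t.2 & k \in zeros a])).
  apply: eq_card => t; rewrite [LHS]inE [RHS]inE /= andbT.
  have [|h1] := eqVneq t.1.1 t.1.2; first by [].
  case hi : (t.1.1 \in zeros a); last by rewrite andbF.
  case hj : (t.1.2 \in zeros a); last by rewrite !andbF.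
  case hk : (t.2 \in zeros a); last by rewrite !andbF.
  rewrite /= !andbT; apply/idP/andP => [h|[h2 h3]].
    by split; apply: contraNneq h => ->; rewrite ?line_l ?line_r.
  by rewrite -det3_line (no_van_det hp hv hi hj hk) // eq_sym.
by move=> t /and3P[h1 h2 h3]; rewrite card_minus2 // hz subSS subn1.
Qed.
End Smooth.

(** * The linear system for the multiplicities *)

(** Here [k] is q, [X] is Q and [m] is n. The unknowns are the multiplicities of two lines ([x1]), a
    line and a point ([x2]), a line ([x3]), a smooth conic ([x4]), and no line with j zeros ([yj]);
    the zero form supplies the constant terms. The last four equations give [x1], [x2], [x4] and
    then [x3]; afterwards the moments of z, in decreasing order, give [y4] down to [y0]. Only
    [x3 + x4] is stated, since both types have the same weight. *)
Lemma moment_system (k X x1 x2 x3 x4 y4 y3 y2 y1 y0 : rat) :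
  let m := k ^+ 2 + k + 1 in
  4 <= k ->
  1 + x1 + x2 + x3 + x4 + y4 + y3 + y2 + y1 + y0 = X ^+ 6 ->
  m + (2 * k + 1) * x1 + (k + 2) * x2 + (k + 1) * (x3 + x4) + 4 * y4 + 3 * y3 + 2 * y2 + y1
    = m * X ^+ 5 ->
  m * (m - 1) + (2 * k + 1) * (2 * k) * x1 + (k + 2) * (k + 1) * x2 + (k + 1) * k * (x3 + x4)
    + 12 * y4 + 6 * y3 + 2 * y2 = m * (m - 1) * X ^+ 4 ->
  m * (m - 1) * (m - 2) + (2 * k + 1) * (2 * k) * (2 * k - 1) * x1 + (k + 2) * (k + 1) * k * x2
    + (k + 1) * k * (k - 1) * (x3 + x4) + 24 * y4 + 6 * y3 = m * (m - 1) * (m - 2) * X ^+ 3 ->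
  m * (m - 1) * (m - 2) * (m - 3) + (2 * k + 1) * (2 * k) * (2 * k - 1) * (2 * k - 2) * x1
    + (k + 2) * (k + 1) * k * (k - 1) * x2 + (k + 1) * k * (k - 1) * (k - 2) * (x3 + x4) + 24 * y4
    = m * (m - 1) * (m - 2) * (m - 3) * X ^+ 2
      + m * (m - 1) * (k - 1) * (k - 2) * (X ^+ 3 - X ^+ 2) ->
  m * (m - 1) + 2 * (k + 1) * k * x1 + (k + 1) * k * x2 + (k + 1) * k * x3
    = m * (m - 1) * X ^+ 3 ->
  m * (m - 1) * k ^+ 2 + 2 * (k + 1) * k ^+ 2 * x1 + (k + 1) * k * x2
    = m * (m - 1) * k ^+ 2 * X ^+ 2 ->
  m * (m - 1) * k ^+ 2 * (k ^+ 2 - 1) + 2 * (k + 1) * k ^+ 2 * (k - 1) * x1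
    = m * (m - 1) * k ^+ 2 * (k ^+ 2 - 1) * X ->
  (k + 1) * k * (k - 1) * x4 = m * (m - 1) * k ^+ 2 * (X - 1) * (k - 1) ^+ 2 ->
 [/\ x1 = m * (k ^+ 2 + k) / 2 * (X - 1),
   x2 = m * k ^+ 2 * (X - k) * (X - 1),
   x3 + x4 = m * (X - 1) *
      (X ^+ 2 - (k ^+ 2 - 1) * X + 2 * k ^+ 3 - 2 * k ^+ 2 - k + 1) &
   [/\ y4 = (m * (k + 1) * k ^+ 3 * (k - 1) ^+ 2 * (X - k) * (X - 1)) / 24,
    y3 = (m * (k + 1) * k ^+ 3 * (X - 1) * (X - k) * (X - (k ^+ 2 - 3 * k + 3))) / 6,
    y2 = (m * (k + 1) * k * (X - 1) * (X - k)
               * (2 * X ^+ 2 - 2 * (k ^+ 2 - k) * X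
                  + (k ^+ 4 - 4 * k ^+ 3 + 7 * k ^+ 2 - 4 * k))) / 4,
    y1 = (m * (X - 1) * (6 * X ^+ 4 - (6 * k ^+ 2 + 6 * k - 6) * X ^+ 3
                  + (3 * k ^+ 4 + 3 * k ^+ 3 - 6 * k) * X ^+ 2
                  - (k ^+ 6 - k ^+ 5 + 5 * k ^+ 4 - 5 * k ^+ 3
                     - 6 * k ^+ 2 + 6 * k) * X
                  + (k ^+ 7 - 4 * k ^+ 6 + 8 * k ^+ 5 - 5 * k ^+ 4
                     - 6 * k ^+ 3 + 9 * k ^+ 2 - 3 * k))) / 6 &
    y0 = ((X - 1) * (X - k)
                * (24 * X ^+ 4 - 24 * k ^+ 2 * X ^+ 3
                   + (12 * k ^+ 4 - 12 * k) * X ^+ 2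
                   - (4 * k ^+ 6 - 4 * k ^+ 5 + 8 * k ^+ 4 - 20 * k ^+ 3
                      + 12 * k ^+ 2) * X
                   + (k ^+ 8 - 4 * k ^+ 7 + 11 * k ^+ 6 - 17 * k ^+ 5
                      + 12 * k ^+ 4 - 3 * k ^+ 3))) / 24]].
Proof.
move=> m k4 E0 E1 E2 E3 E4 V1 V2 V3 K.
have k0 : k != 0 by lra.
have k1 : k - 1 != 0 by lra.
have k2 : k + 1 != 0 by lra.
have sol (c x y : rat) : c != 0 -> c * x = c * y -> x = y by move=> c0; apply: mulfI.
rewrite /m in E0 E1 E2 E3 E4 V1 V2 V3 K *.
(* The unordered pairs of distinct F-lines, times the scalars of L. *)
have X1 : x1 = (k ^+ 2 + k + 1) * (k ^+ 2 + k) / 2 * (X - 1).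
  apply: (@sol (2 * (k + 1) * k ^+ 2 * (k - 1))); first by rewrite !mulf_neq0.
  move: V3 => /eqP; rewrite -subr_eq0 => /eqP V3.
  apply/eqP; rewrite -subr_eq0 -[X in _ == X]V3; by apply/eqP; field.
(* An F-line, a point off it, one of the [X - k] lines over L through that point not defined over F,
   and a scalar. *)
have X2 : x2 = (k ^+ 2 + k + 1) * k ^+ 2 * (X - k) * (X - 1).
  apply: (@sol ((k + 1) * k)); first by rewrite !mulf_neq0.
  move: V2; rewrite X1 => /eqP; rewrite -subr_eq0 => /eqP V2.
  apply/eqP; rewrite -subr_eq0 -[X in _ == X]V2; by apply/eqP; field.
(* The first two factors give k^5 - k^2, the number of smooth conics over F. *)
have X4 : x4 = (k ^+ 2 + k + 1) * (k ^+ 3 - k ^+ 2) * (X - 1).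
  apply: (@sol ((k + 1) * k * (k - 1))); first by rewrite !mulf_neq0.
  by rewrite K; field.
have X34 : x3 + x4 = (k ^+ 2 + k + 1) * (X - 1) *
      (X ^+ 2 - (k ^+ 2 - 1) * X + 2 * k ^+ 3 - 2 * k ^+ 2 - k + 1).
  apply: (@sol ((k + 1) * k)); first by rewrite !mulf_neq0.
  rewrite mulrDr; move: V1; rewrite X1 X2 X4 => /eqP; rewrite -subr_eq0 => /eqP V1.
  apply/eqP; rewrite -subr_eq0 -[X in _ == X]V1; by apply/eqP; field.
have sol' (c x r s t : rat) : c != 0 -> r + c * x = s -> c * t = s - r -> x = t.
  by move=> c0 <- h; apply: (mulfI c0); rewrite h addrAC subrr add0r.
have sol1 (x r s t : rat) : r + x = s -> t = s - r -> x = t.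
  by move=> <- ->; rewrite addrAC subrr add0r.
(* Ordered quadruples with no three points collinear, over 4!. Of the X + 1 conics through such
   points, the k + 1 defined over F have further zeros; the other [X - k] remain, each with [X - 1]
   scalars. *)
have Y4 : y4 = ((k ^+ 2 + k + 1) * (k + 1) * k ^+ 3 * (k - 1) ^+ 2 * (X - k) * (X - 1)) / 24.
  by move: E4; rewrite X1 X2 X34 => E4; apply: (sol' _ _ _ _ _ _ E4) => //; field.
have Y3 : y3 = ((k ^+ 2 + k + 1) * (k + 1) * k ^+ 3 * (X - 1) * (X - k) * (X - (k ^+ 2 - 3 * k
  + 3))) / 6.
  by move: E3; rewrite X1 X2 X34 Y4 => E3; apply: (sol' _ _ _ _ _ _ E3) => //; field.
have Y2 : y2 = ((k ^+ 2 + k + 1) * (k + 1) * k * (X - 1) * (X - k)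
               * (2 * X ^+ 2 - 2 * (k ^+ 2 - k) * X
                  + (k ^+ 4 - 4 * k ^+ 3 + 7 * k ^+ 2 - 4 * k))) / 4.
  by move: E2; rewrite X1 X2 X34 Y4 Y3 => E2; apply: (sol' _ _ _ _ _ _ E2) => //; field.
have Y1 : y1 = ((k ^+ 2 + k + 1) * (X - 1) * (6 * X ^+ 4 - (6 * k ^+ 2 + 6 * k - 6) * X ^+ 3
                  + (3 * k ^+ 4 + 3 * k ^+ 3 - 6 * k) * X ^+ 2
                  - (k ^+ 6 - k ^+ 5 + 5 * k ^+ 4 - 5 * k ^+ 3
                     - 6 * k ^+ 2 + 6 * k) * X
                  + (k ^+ 7 - 4 * k ^+ 6 + 8 * k ^+ 5 - 5 * k ^+ 4
                     - 6 * k ^+ 3 + 9 * k ^+ 2 - 3 * k))) / 6.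
  move: E1; rewrite X1 X2 X34 Y4 Y3 Y2 => E1.
  by apply: (sol1 _ _ _ _ E1); field.
split => //; split => //.
move: E0; rewrite -(addrA _ x3) X1 X2 X34 Y4 Y3 Y2 Y1 => E0.
by apply: (sol1 _ _ _ _ E0); field.
Qed.

Lemma natr_ff2 (m : nat) : (m * m.-1)%:R = m%:R * (m%:R - 1) :> rat.
Proof. by case: m => [|m] /=; rewrite ?mul0r // natrM -(natr1 m) addrK. Qed.

Lemma natr_ff3 (m : nat) : (m * m.-1 * (m - 2))%:R = m%:R * (m%:R - 1) * (m%:R - 2) :> rat.
Proof.
case: m => [|[|m]]; [by rewrite !mul0r|by rewrite subrr mulr0 mul0r|].
by rewrite natrM natr_ff2 natrB.
Qed.

Lemma natr_ff4 (m : nat) : (m * m.-1 * ((m - 2) * (m - 2).-1))%:R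
  = m%:R * (m%:R - 1) * (m%:R - 2) * (m%:R - 3) :> rat.
Proof.
case: m => [|[|m]]; [by rewrite !mul0r|by rewrite subrr mulr0 !mul0r|].
rewrite natrM !natr_ff2 natrB // mulrA; congr (_ * _); ring.
Qed.

(** * The multiplicities of the ten types *)

Section WeightCounts.
Variables (F : finFieldType) (q n : nat) (p : 'I_n -> 'rV[F]_3).
Hypotheses (hF : #|F| = q) (hn : n = (q ^ 2 + q + 1)%N) (hp : proj_representatives p).
Hypothesis hq : (4 <= q)%N.
Variables (L : finFieldType) (iota : {rmorphism F -> L}).
Implicit Types (a : 'rV[L]_6).
Local Notation Q := #|L|.
Local Notation z a := #|zeros p iota a|.
Local Notation lam := (lam p iota).
Local Notation types := (types q n).

Definition ntype t := #|[set a | (lam a, z a) == t]|.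

(** The key 2 z + [lam != 0] decreases strictly along the list: the only tie in z, at q + 1, is
    broken by the presence of a line, and [4 <= q] keeps q + 1 above 4. *)
Lemma types_uniq : uniq types.
Proof.
have h1 : (2 * q + 1 < n)%N by rewrite hn; move: hq; nia.
have h2 : (2 * (q.+1 * q) < n * n.-1)%N by rewrite hn; move: hq; nia.
have h3 : (0 < q.+1 * q)%N by move: hq; nia.
have e1 : (n * n.-1 == 0)%N = false by apply/negbTE; rewrite -lt0n; apply: leq_ltn_trans h2.
have e2 : (2 * (q.+1 * q) == 0)%N = false by apply/negbTE; rewrite -lt0n muln_gt0 h3.
have e3 : (q.+1 * q == 0)%N = false by apply/negbTE; rewrite -lt0n h3.
apply: (map_uniq (f := fun t : nat * nat => (2 * t.2 + (t.1 != 0))%N)).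
apply: (sorted_uniq (leT := gtn)); first by move=> x y w /= a1 a2; apply: ltn_trans a2 a1.
  by move=> x; rewrite /= ltnn.
by rewrite /types /= e1 e2 e3 /=; move: hq h1; lia.
Qed.

(** Makes the truncated subtraction [z a - q.+1] harmless in the moments: whenever it truncates, the
    factor [lam a] is zero. *)
Lemma lam_eq0_or a : lam a = 0%N \/ (q.+1 <= z a)%N.
Proof.
have [|/set0Pn[[i j]]] := eqVneq [set t : 'I_n * 'I_n | (t.1 != t.2) && van p iota a t.1 t.2]
  set0.
  by rewrite /lam => ->; left; rewrite cards0.
rewrite inE /= => /andP[ij hv]; right; rewrite -(card_line hF hn hp ij).
exact/subset_leq_card/van_zeros.
Qed.

Lemma sum_types (f : nat * nat -> rat) :
  \sum_(a : 'rV[L]_6) f (lam a, z a) = \sum_(t <- types) (ntype t)%:R * f t.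
Proof.
transitivity (\sum_(a : 'rV[L]_6) \sum_(t <- types) (((lam a, z a) == t)%:R * f t)).
  apply: eq_bigr => a _; rewrite (bigD1_seq _ (classification hF hn hp iota hq a) types_uniq) /=.
  rewrite eqxx mul1r big1 ?addr0 // => t; rewrite eq_sym => /negPf->; exact: mul0r.
rewrite exchange_big /=; apply: eq_bigr => t _; rewrite -mulr_suml; congr (_ * _).
rewrite /ntype -sum1_card natr_sum [RHS]big_mkcond; apply: eq_bigr => a _.
by rewrite inE; case: (_ == _).
Qed.

Lemma ntype0 : ntype (n * n.-1, n)%N = 1%N.
Proof.
transitivity #|[set (0 : 'rV[L]_6)]|; last by rewrite cards1.
apply: eq_card => a; rewrite !inE.
have [h1 h2] := type0 p iota.
apply/eqP/eqP => [[_ /(zeros_all hp)] //|->]; by rewrite h1 h2.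
Qed.

Let k : rat := q%:R.
Let X : rat := Q%:R.
Local Notation N u v := ((ntype (u, v)%N)%:R : rat).

Lemma n_rat : n%:R = k ^+ 2 + k + 1 :> rat.
Proof. by rewrite hn !natrD natrX. Qed.

Lemma k_ge4 : 4 <= k.
Proof. by rewrite /k (ler_nat _ 4). Qed.

Lemma big_types (f : nat * nat -> rat) : \sum_(t <- types) (ntype t)%:R * f t =
  f (n * n.-1, n)%N + N (2 * (q.+1 * q)) (2 * q + 1) * f (2 * (q.+1 * q), 2 * q + 1)%N
  + N (q.+1 * q) (q + 2) * f (q.+1 * q, q + 2)%N + N (q.+1 * q) (q + 1) * f (q.+1 * q, q + 1)%N
  + N 0 (q + 1) * f (0, q + 1)%N + N 0 4 * f (0, 4)%N + N 0 3 * f (0, 3)%N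
  + N 0 2 * f (0, 2)%N + N 0 1 * f (0, 1)%N + N 0 0 * f (0, 0)%N.
Proof. by rewrite /types !big_cons big_nil ntype0 mul1r addr0 !addrA. Qed.

Lemma weight_counts : let m := k ^+ 2 + k + 1 in
 [/\ N (2 * (q.+1 * q)) (2 * q + 1) = m * (k ^+ 2 + k) / 2 * (X - 1),
   N (q.+1 * q) (q + 2) = m * k ^+ 2 * (X - k) * (X - 1),
   N (q.+1 * q) (q + 1) + N 0 (q + 1) = m * (X - 1) *
      (X ^+ 2 - (k ^+ 2 - 1) * X + 2 * k ^+ 3 - 2 * k ^+ 2 - k + 1) &
   [/\ N 0 4 = (m * (k + 1) * k ^+ 3 * (k - 1) ^+ 2 * (X - k) * (X - 1)) / 24,
    N 0 3 = (m * (k + 1) * k ^+ 3 * (X - 1) * (X - k) * (X - (k ^+ 2 - 3 * k + 3))) / 6,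
    N 0 2 = (m * (k + 1) * k * (X - 1) * (X - k)
               * (2 * X ^+ 2 - 2 * (k ^+ 2 - k) * X
                  + (k ^+ 4 - 4 * k ^+ 3 + 7 * k ^+ 2 - 4 * k))) / 4,
    N 0 1 = (m * (X - 1) * (6 * X ^+ 4 - (6 * k ^+ 2 + 6 * k - 6) * X ^+ 3
                  + (3 * k ^+ 4 + 3 * k ^+ 3 - 6 * k) * X ^+ 2
                  - (k ^+ 6 - k ^+ 5 + 5 * k ^+ 4 - 5 * k ^+ 3
                     - 6 * k ^+ 2 + 6 * k) * X
                  + (k ^+ 7 - 4 * k ^+ 6 + 8 * k ^+ 5 - 5 * k ^+ 4
                     - 6 * k ^+ 3 + 9 * k ^+ 2 - 3 * k))) / 6 &
    N 0 0 = ((X - 1) * (X - k)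
                * (24 * X ^+ 4 - 24 * k ^+ 2 * X ^+ 3
                   + (12 * k ^+ 4 - 12 * k) * X ^+ 2
                   - (4 * k ^+ 6 - 4 * k ^+ 5 + 8 * k ^+ 4 - 20 * k ^+ 3
                      + 12 * k ^+ 2) * X
                   + (k ^+ 8 - 4 * k ^+ 7 + 11 * k ^+ 6 - 17 * k ^+ 5
                      + 12 * k ^+ 4 - 3 * k ^+ 3))) / 24]].
Proof.
have k4 := k_ge4.
have qS : q.+1%:R = k + 1 :> rat by rewrite -natr1.
have nS : (n - q.+1)%:R = k ^+ 2 :> rat.
  rewrite natrB; last by rewrite hn; lia.
  by rewrite n_rat qS; ring.
have qP : q.-1%:R = k - 1 :> rat.
  by rewrite /k; move: hq; case: (q) => // r _; rewrite -(natr1 r) addrK.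
have QP : Q.-1%:R = X - 1 :> rat.
  by rewrite /X; have := finNzRing_gt1 L; case: #|_| => // r _; rewrite -(natr1 r) addrK.
have qPP : (q.-1 * q.-2)%:R = (k - 1) * (k - 2) :> rat.
  by rewrite natr_ff2 qP; ring.
have lamz a : (lam a)%:R * (z a - q.+1)%:R = (lam a)%:R * ((z a)%:R - (k + 1)) :> rat.
  by have [->|le] := lam_eq0_or a; [rewrite !mul0r|rewrite natrB // qS].
have lamz2 a : (lam a)%:R * ((z a - q.+1) * (z a - q.+1).-1)%:R =
    (lam a)%:R * (((z a)%:R - (k + 1)) * ((z a)%:R - (k + 2))) :> rat.
  have [->|le] := lam_eq0_or a; first by rewrite !mul0r.
  by rewrite natr_ff2 natrB // qS; ring.
have eqR (u v : nat) : u = v -> u%:R = v%:R :> rat by move=> ->.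
have types_sum f := esym (etrans (sum_types f) (big_types f)).
rewrite /=; apply: moment_system => //.
- have := types_sum (fun=> 1); rewrite sumr_const card_mx mul1n natrX -/X !mulr1.
  by [].
- have := eqR _ _ (moment1 hF hn hp hq iota); rewrite natr_sum natrM natrX -/X n_rat => <-.
  by rewrite -(types_sum (fun t => t.2%:R)) /= !(natrM, natrD) n_rat -/k; ring.
- have := eqR _ _ (moment2 hp iota); rewrite natr_sum natrM natrX natr_ff2 -/X n_rat => <-.
  under eq_bigr do rewrite natr_ff2.
  rewrite -(types_sum (fun t => t.2%:R * (t.2%:R - 1))) /= !(natrM, natrD) n_rat -/k; ring.
- have := eqR _ _ (moment3 hp iota); rewrite natr_sum natrM natrX natr_ff3 -/X n_rat => <-.
  under eq_bigr do rewrite natr_ff3.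
  rewrite -(types_sum (fun t => t.2%:R * (t.2%:R - 1) * (t.2%:R - 2))) /= !(natrM, natrD) n_rat
    -/k; ring.
- have := eqR _ _ (moment4 hF hn hp hq iota).
  rewrite !natrD natr_sum !(natrM _ _ (Q ^ _)) natr_ff4 (natrM _ _ (q.-1 * q.-2)) qPP natr_ff2.
  rewrite !natrX -/X n_rat => /(canRL (addrK _)).
  under eq_bigr do rewrite natr_ff4.
  rewrite -(types_sum (fun t => t.2%:R * (t.2%:R - 1) * (t.2%:R - 2) * (t.2%:R - 3))) /=.
  rewrite !(natrM, natrD) n_rat -/k => e.
  by apply: (etrans (etrans _ e) _); ring.
- have := eqR _ _ (van_moment1 hp iota); rewrite natr_sum natrM natrX natr_ff2 -/X n_rat => <-.
  by rewrite -(types_sum (fun t => t.1%:R)) /= natr_ff2 !(natrM, natrD) n_rat qS -/k; ring.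
- have := eqR _ _ (van_moment2 hF hn hp iota);
  rewrite natr_sum natrM natrX (natrM _ _ (n - q.+1)) natr_ff2 -/X nS n_rat => <-.
  under eq_bigr do rewrite natrM lamz.
  rewrite -(types_sum (fun t => t.1%:R * (t.2%:R - (k + 1)))) /= natr_ff2 !(natrM, natrD) n_rat
    qS -/k; ring.
- have := eqR _ _ (van_moment3 hF hn hp iota); rewrite natr_sum 2!natrM !natr_ff2 -/X nS n_rat.
  under eq_bigr do rewrite natrM lamz2.
  rewrite -(types_sum (fun t => t.1%:R * ((t.2%:R - (k + 1)) * (t.2%:R - (k + 2))))) /=.
  rewrite natr_ff2 !(natrM, natrD) n_rat qS -/k => e.
  by apply: (etrans _ (etrans e _)); ring.
- have := eqR _ _ (smooth_count hF hn hp hq iota).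
  have -> : [set a | (lam a == 0%N) && (z a == q.+1)] = [set a | (lam a, z a) == (0, q + 1)%N].
    by apply/setP => a; rewrite !inE xpair_eqE addn1.
  rewrite -/(ntype (0, q + 1)%N) natrM !(natrM _ _ (Q.-1 * _)) (natrM _ _ (n - _)) natr_ff2 nS
    n_rat.
  rewrite !natrM qS qP QP -/k => e; rewrite -(mulrC (N 0 (q + 1))) !mulrA in e *.
  rewrite e; ring.
Qed.
End WeightCounts.

(** * Codewords and finite extensions *)

Section Encoding.
Variables (F L : finFieldType) (iota : {rmorphism F -> L}) (n : nat) (pts : 'I_n -> 'rV[F]_3).

Definition enc (a : 'rV[L]_6) : 'rV[L]_n := a *m map_mx iota (veronese_gen pts).

Lemma encE a j : enc a ord0 j = qf iota a (pts j).
Proof. by rewrite mxE /qf; apply: eq_bigr => k _; rewrite !mxE. Qed.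

Lemma veronese_codeP c : reflect (exists b, c = b *m veronese_gen pts) (c \in veronese_code pts).
Proof.
apply: (iffP idP) => [|[b ->]]; last first.
  rewrite mulmx_sum_row; apply: memv_suml => k _; apply/memvZ/memv_span.
  by apply/mapP; exists k; rewrite ?mem_enum.
have sub : (veronese_code pts <= limg (linfun (mulmxr (veronese_gen pts) : 'rV_6 -> 'rV_n)))%VS.
  apply/span_subvP => _ /mapP[k _ ->]; rewrite rowE.
  have -> : delta_mx 0 k *m veronese_gen pts =
    linfun (mulmxr (veronese_gen pts) : 'rV_6 -> 'rV_n) (delta_mx 0 k) by rewrite lfunE.
  by rewrite memv_img ?memvf.
by move=> /(subvP sub)/memv_imgP[b _ ->]; exists b; rewrite lfunE.
Qed.

Lemma code_extP c : reflect (exists a, c = enc a) (c \in code_ext iota (veronese_code pts)).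
Proof.
apply: (iffP idP) => [|[a ->]]; last first.
  rewrite /enc mulmx_sum_row; apply: memv_suml => k _; apply/memvZ/memv_span.
  rewrite -map_row; apply: image_f.
  by apply: memv_span; apply/mapP; exists k; rewrite ?mem_enum.
have sub : (code_ext iota (veronese_code pts) <= limg (linfun (mulmxr (map_mx iota
  (veronese_gen pts)) : 'rV_6 -> 'rV_n)))%VS.
  apply/span_subvP => _ /imageP[c0 /veronese_codeP[b ->] ->]; rewrite map_mxM.
  have -> : map_mx iota b *m map_mx iota (veronese_gen pts) =
    linfun (mulmxr (map_mx iota (veronese_gen pts)) : 'rV_6 -> 'rV_n) (map_mx iota b) by
      rewrite lfunE.
  by rewrite memv_img ?memvf.
by move=> /(subvP sub)/memv_imgP[b _ ->]; exists b; rewrite lfunE.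
Qed.

Lemma wt_enc a : (wt (enc a) = n - #|zeros pts iota a|)%N.
Proof.
rewrite /wt -[X in (X - _)%N](card_ord n) -(cardC (zeros pts iota a)) addKn.
by apply: eq_card => j; rewrite !inE encE.
Qed.

Hypothesis hpts : proj_representatives pts.

Lemma enc_inj : injective enc.
Proof.
move=> a b e; apply/eqP; rewrite -subr_eq0; apply/eqP/(zeros_all hpts (iota := iota)).
rewrite -[RHS]card_ord -cardsT; congr #|pred_of_set _|; apply/setP => j; rewrite !inE.
by rewrite -encE /enc mulmxBl -/(enc a) -/(enc b) e subrr mxE eqxx.
Qed.

Lemma card_codewords w : (w <= n)%N ->
  #|[set c : 'rV[L]_n | (c \in code_ext iota (veronese_code pts)) && (wt c == w)]|
  = #|[set a : 'rV[L]_6 | #|zeros pts iota a| == (n - w)%N]|.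
Proof.
move=> hw; rewrite -(card_imset _ enc_inj); apply: eq_card => c; rewrite inE.
have zn a : (#|zeros pts iota a| <= n)%N by rewrite -[X in (_ <= X)%N](card_ord n) max_card.
apply/andP/imsetP => [[/code_extP[a ->] h]|[a]]; last first.
  rewrite inE => h ->; split; first by apply/code_extP; exists a.
  by rewrite wt_enc (eqP h) subKn.
by exists a => //; rewrite inE -(eqP h) wt_enc subKn.
Qed.
End Encoding.

(* The splitting field over F of X^m - X, m = #|F|^i: its roots are the fixed
   points of a power of the Frobenius, so they already form a field. *)
Lemma exists_field_ext (F : finFieldType) (i : nat) : (0 < i)%N ->
  exists (L : finFieldType) (iota : {rmorphism F -> L}), #|L| = (#|F| ^ i)%N.
Proof.
move=> i0; set m := (#|F| ^ i)%N.
have m_gt1 : (1 < m)%N by rewrite -(exp1n i) ltn_exp2r // finNzRing_gt1.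
have m_gt0 := ltnW m_gt1; have m1_gt0: (m.-1 > 0)%N by rewrite -ltnS prednK.
pose g (R : nzRingType) : {poly R} := 'X^m - 'X.
have Dg (R : nzRingType) : g R = ('X^(m.-1) - 1) * ('X - 0).
  by rewrite subr0 mulrBl mul1r -exprSr prednK.
have /FinSplittingFieldFor[/= L splitLg]: g F != 0.
  by rewrite Dg monic_neq0 ?rpredM ?monicXsubC ?monicXnsubC.
rewrite [map_poly _ _]rmorphB rmorphXn /= map_polyX -/(g L) in splitLg.
have [p p_pr pcharF] := finPcharP F.
have pcharL : p \in [pchar L] by rewrite pchar_lalg.
have m0 : m%:R = 0 :> L.
  apply/eqP; rewrite -(dvdn_pcharf pcharL); apply: dvdn_exp => //.
  by rewrite (dvdn_pcharf pcharF) -cardsT -order_dvdn order_dvdG ?inE.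
pose Lf := FinFieldExtType L; exists Lf, (in_alg L).
have /finField_galois_generator[/= a _ Da]: (1 <= {:L})%VS by apply: sub1v.
pose Em := fixedSpace (a ^+ i)%g; rewrite /= dimv1 expn1 in Da.
have [zs DgL defL] := splitLg.
(* X^m - X is X^(m-1) - 1 times X. The first factor is separable because m - 1 is -1, a unit, in L,
   and it does not vanish at 0. *)
have Uzs: uniq zs.
  rewrite -separable_prod_XsubC -(eqp_separable DgL) Dg separable_root andbC.
  rewrite /root !hornerE subr_eq0 eq_sym expr0n gtn_eqF ?oner_eq0 //=.
  by rewrite cyclotomic.separable_Xn_sub_1 // -subn1 natrB // m0 sub0r oppr_eq0 oner_eq0.
suffices /eq_card->: Lf =i zs.
  apply: succn_inj; rewrite (card_uniqP _) //= -(size_prod_XsubC _ id).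
  by rewrite -(eqp_size DgL) size_polyDl size_polyXn // size_polyN size_polyX.
(* The generator [a] raises to the power #|F|, so its i-th power raises to the power m, and its
   fixed points are the roots. *)
have in_zs: zs =i Em.
  move=> z; rewrite -root_prod_XsubC -(eqp_root DgL) (sameP fixedSpaceP eqP).
  rewrite /root !hornerE subr_eq0 /= /m; congr (_ == z).
  elim: (i) => [|k IHk]; first by rewrite gal_id.
  by rewrite expgSr expnSr exprM IHk galM ?Da ?memvf.
(* [Em] is a subfield containing F and all the roots, and the roots generate L. *)
suffices defEm: Em = {:L}%VS by move=> z; rewrite in_zs defEm memvf.
apply/eqP; rewrite eqEsubv subvf -defL -[Em]subfield_closed agenvS //.
by rewrite subv_add sub1v; apply/span_subvP=> z; rewrite in_zs.
Qed.

(** * The generalized weight polynomials *)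

(** Integrality reduces to the divisibility by 2, 6 or 24 of integer polynomials in q. Each becomes
    the vanishing of a function on Z/d, decided by evaluating it at all residues. *)
Lemma dvdz_Zp (d : nat) (z : int) : (1 < d)%N -> z%:~R = 0 :> 'Z_d ->
  exists c : int, z = d%:Z * c.
Proof.
move=> d1 h; suff /dvdzP[c ->] : (d%:Z %| z)%Z by exists c; rewrite mulrC.
have nat0 (m : nat) : m%:R = 0 :> 'Z_d -> (d %| m)%N.
  by move=> /(congr1 val) /=; rewrite val_Zp_nat // => e; apply/eqP.
case: z h => [m|m]; first by rewrite -pmulrn => /nat0.
by rewrite NegzE rmorphN /= => /eqP; rewrite oppr_eq0 -pmulrn => /eqP/nat0.
Qed.

Lemma Zp_all (d : nat) (f : 'Z_d.+2 -> 'Z_d.+2) :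
  all (fun i => f (inZp i) == 0) (iota 0 d.+2) -> forall x, f x = 0.
Proof.
by move=> /allP h x; have := h x; rewrite mem_iota ltn_ord => /(_ isT)/eqP; rewrite valZpK.
Qed.

Ltac intr_morph :=
  rewrite !(rmorphD, rmorphB, rmorphN, rmorphM, rmorphXn, rmorph1, rmorph_nat) /=.

Ltac divide_by d :=
  apply: (@dvdz_Zp d) => //; intr_morph; move: (_%:~R); apply: Zp_all; vm_compute; reflexivity.

Section Integrality.
Variable k : int.
Local Notation m := (k ^+ 2 + k + 1).

Lemma dvd_y4 : exists c : int, m * (k + 1) * k ^+ 3 * (k - 1) ^+ 2 = 24%:Z * c.
Proof. divide_by 24%N. Qed.

Lemma dvd_y3 : exists c : int, m * (k + 1) * k ^+ 3 = 6%:Z * c.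
Proof. divide_by 6%N. Qed.

(** The denominator 4 is split: one factor 2 is taken from this prefactor, the other from the
    coefficients of the quadratic in Z. *)
Lemma dvd_y2 : exists c : int, m * (k + 1) * k = 2%:Z * c.
Proof. divide_by 2%N. Qed.

Lemma dvd_y2_0 : exists c : int, k ^+ 4 - 4 * k ^+ 3 + 7 * k ^+ 2 - 4 * k = 2%:Z * c.
Proof. divide_by 2%N. Qed.

Lemma dvd_y1_2 : exists c : int, 3 * k ^+ 4 + 3 * k ^+ 3 - 6 * k = 6%:Z * c.
Proof. divide_by 6%N. Qed.

Lemma dvd_y1_1 : exists c : int,
  m * (k ^+ 6 - k ^+ 5 + 5 * k ^+ 4 - 5 * k ^+ 3 - 6 * k ^+ 2 + 6 * k) = 6%:Z * c.
Proof. divide_by 6%N. Qed.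

Lemma dvd_y1_0 : exists c : int,
  m * (k ^+ 7 - 4 * k ^+ 6 + 8 * k ^+ 5 - 5 * k ^+ 4 - 6 * k ^+ 3 + 9 * k ^+ 2 - 3 * k) = 6%:Z
    * c.
Proof. divide_by 6%N. Qed.

Lemma dvd_y0_2 : exists c : int, 12 * k ^+ 4 - 12 * k = 24%:Z * c.
Proof. divide_by 24%N. Qed.

Lemma dvd_y0_1 : exists c : int,
  4 * k ^+ 6 - 4 * k ^+ 5 + 8 * k ^+ 4 - 20 * k ^+ 3 + 12 * k ^+ 2 = 24%:Z * c.
Proof. divide_by 24%N. Qed.

Lemma dvd_y0_0 : exists c : int,
  k ^+ 8 - 4 * k ^+ 7 + 11 * k ^+ 6 - 17 * k ^+ 5 + 12 * k ^+ 4 - 3 * k ^+ 3 = 24%:Z * c.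
Proof. divide_by 24%N. Qed.
End Integrality.

Definition weights (q : nat) : seq nat :=
  [:: 0; q ^ 2 - q; q ^ 2 - 1; q ^ 2; q ^ 2 + q - 3; q ^ 2 + q - 2; q ^ 2 + q - 1; q ^ 2 + q;
      q ^ 2 + q + 1]%N.

Definition weight_polys (q : nat) : seq {poly rat} :=
  let Z : {poly rat} := 'X in
  let k : {poly rat} := q%:R in
  [:: 1; 'C(q ^ 2 + q + 1, 2)%:R * (Z - 1);
      (k ^+ 2 + k + 1) * k ^+ 2 * (Z - k) * (Z - 1);
      (k ^+ 2 + k + 1) * (Z - 1) *
      (Z ^+ 2 - (k ^+ 2 - 1) * Z + 2 * k ^+ 3 - 2 * k ^+ 2 - k + 1);
      24^-1 *: ((k ^+ 2 + k + 1) * (k + 1) * k ^+ 3 * (k - 1) ^+ 2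
                * (Z - k) * (Z - 1));
      6^-1 *: ((k ^+ 2 + k + 1) * (k + 1) * k ^+ 3 * (Z - 1) * (Z - k)
               * (Z - (k ^+ 2 - 3 * k + 3)));
      4^-1 *: ((k ^+ 2 + k + 1) * (k + 1) * k * (Z - 1) * (Z - k)
               * (2 * Z ^+ 2 - 2 * (k ^+ 2 - k) * Z
                  + (k ^+ 4 - 4 * k ^+ 3 + 7 * k ^+ 2 - 4 * k)));
      6^-1 *: ((k ^+ 2 + k + 1) * (Z - 1)
               * (6 * Z ^+ 4 - (6 * k ^+ 2 + 6 * k - 6) * Z ^+ 3
                  + (3 * k ^+ 4 + 3 * k ^+ 3 - 6 * k) * Z ^+ 2
                  - (k ^+ 6 - k ^+ 5 + 5 * k ^+ 4 - 5 * k ^+ 3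
                     - 6 * k ^+ 2 + 6 * k) * Z
                  + (k ^+ 7 - 4 * k ^+ 6 + 8 * k ^+ 5 - 5 * k ^+ 4
                     - 6 * k ^+ 3 + 9 * k ^+ 2 - 3 * k)));
      24^-1 *: ((Z - 1) * (Z - k)
                * (24 * Z ^+ 4 - 24 * k ^+ 2 * Z ^+ 3
                   + (12 * k ^+ 4 - 12 * k) * Z ^+ 2
                   - (4 * k ^+ 6 - 4 * k ^+ 5 + 8 * k ^+ 4 - 20 * k ^+ 3
                      + 12 * k ^+ 2) * Z
                   + (k ^+ 8 - 4 * k ^+ 7 + 11 * k ^+ 6 - 17 * k ^+ 5
                      + 12 * k ^+ 4 - 3 * k ^+ 3)))].

Lemma inv_scale (d : nat) (A B : {poly rat}) : (0 < d)%N -> A = d%:R * B -> d%:R^-1 *: A = B.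
Proof.
move=> d0 ->; rewrite mulr_natl -scaler_nat scalerA mulVf ?scale1r //.
by rewrite pnatr_eq0 -lt0n.
Qed.

Lemma weight_polys_integral (q : nat) :
  exists ps : seq {poly int}, map (map_poly intr) ps = weight_polys q.
Proof.
have [y4 e4] := dvd_y4 q%:Z; have [y3 e3] := dvd_y3 q%:Z.
have [y2 e2] := dvd_y2 q%:Z; have [y20 e20] := dvd_y2_0 q%:Z.
have [y12 e12] := dvd_y1_2 q%:Z; have [y11 e11] := dvd_y1_1 q%:Z; have [y10 e10] := dvd_y1_0 q%:Z.
have [y02 e02] := dvd_y0_2 q%:Z; have [y01 e01] := dvd_y0_1 q%:Z; have [y00 e00] := dvd_y0_0 q%:Z.
pose Z : {poly int} := 'X; pose k : {poly int} := q%:R; pose m := k ^+ 2 + k + 1.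
exists [:: 1; 'C(q ^ 2 + q + 1, 2)%:R * (Z - 1); m * k ^+ 2 * (Z - k) * (Z - 1);
      m * (Z - 1) * (Z ^+ 2 - (k ^+ 2 - 1) * Z + 2 * k ^+ 3 - 2 * k ^+ 2 - k + 1);
      y4%:~R * (Z - k) * (Z - 1);
      y3%:~R * (Z - 1) * (Z - k) * (Z - (k ^+ 2 - 3 * k + 3));
      y2%:~R * (Z - 1) * (Z - k) * (Z ^+ 2 - (k ^+ 2 - k) * Z + y20%:~R);
      (Z - 1) * (m * Z ^+ 4 - m * (k ^+ 2 + k - 1) * Z ^+ 3 + m * y12%:~R * Z ^+ 2
         - y11%:~R * Z + y10%:~R);
      (Z - 1) * (Z - k) * (Z ^+ 4 - k ^+ 2 * Z ^+ 3 + y02%:~R * Z ^+ 2 - y01%:~R * Z + y00%:~R)].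
have cast (a b : int) : a = b -> a%:~R = b%:~R :> {poly rat} by move=> ->.
have f4 := cast _ _ e4; have f3 := cast _ _ e3; have f2 := cast _ _ e2; have f20 := cast _ _ e20.
have f12 := cast _ _ e12; have f11 := cast _ _ e11; have f10 := cast _ _ e10.
have f02 := cast _ _ e02; have f01 := cast _ _ e01; have f00 := cast _ _ e00.
rewrite !(rmorphXn, rmorph_nat, rmorphB, rmorphM, rmorphD, rmorph1) /= -!pmulrn
  in f4 f3 f2 f20 f12 f11 f10 f02 f01 f00.
rewrite /= /weight_polys /m /Z /k.
rewrite !(rmorphXn, rmorph_nat, rmorph_int, rmorphB, rmorphM, rmorphD, rmorph1) /= !map_polyX.
set K : {poly rat} := q%:R; set X : {poly rat} := 'X.
rewrite -!/K in f4 f3 f2 f20 f12 f11 f10 f02 f01 f00.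
congr [:: _; _; _; _; _; _; _; _; _]; apply/esym/inv_scale => //.
- by rewrite f4; ring.
- by rewrite f3; ring.
- by rewrite f20 f2; ring.
(* Regrouped so that the left-hand sides of [f12], [f11] and [f10] occur literally. *)
- transitivity ((X - 1) * ((K ^+ 2 + K + 1) * (6 * X ^+ 4 - (6 * K ^+ 2 + 6 * K - 6) * X ^+ 3)
    + (K ^+ 2 + K + 1) * (3 * K ^+ 4 + 3 * K ^+ 3 - 6 * K) * X ^+ 2
    - (K ^+ 2 + K + 1) * (K ^+ 6 - K ^+ 5 + 5 * K ^+ 4 - 5 * K ^+ 3 - 6 * K ^+ 2 + 6 * K) * X
    + (K ^+ 2 + K + 1) * (K ^+ 7 - 4 * K ^+ 6 + 8 * K ^+ 5 - 5 * K ^+ 4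
                     - 6 * K ^+ 3 + 9 * K ^+ 2 - 3 * K))); first by ring.
  by rewrite f12 f11 f10; ring.
- by rewrite f02 f01 f00; ring.
Qed.

(** Every factor has a nonzero value at Z = 0. With k = r + 4 and r nonnegative, most of these
    values are polynomials in r whose coefficients all have one sign; the two of highest degree are
    split into nonnegative terms in k. *)
Lemma weight_polys_neq0 (q : nat) : (4 <= q)%N -> all (fun p => p != 0) (weight_polys q).
Proof.
move=> hq; have k4 : 4 <= q%:R :> rat by rewrite (ler_nat _ 4).
have nz (p : {poly rat}) : p.[0] != 0 -> p != 0 by apply: contraNneq => ->; rewrite horner0.
pose k : rat := q%:R; pose r := k - 4; have kr : k = r + 4 by rewrite /r; ring.
have r0 : 0 <= r by rewrite /r; lra.
have hk : (q%:R : {poly rat}).[0] = k by rewrite hornerMn hornerC.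
have hn (d : nat) : (d%:R : {poly rat}).[0] = d%:R by rewrite hornerMn hornerC.
have rp i : 0 <= r ^+ i by rewrite exprn_ge0.
have r2 := rp 2; have r3 := rp 3; have r4 := rp 4.
have kp : 0 < k by rewrite kr; lra.
have C0 : 'C(q ^ 2 + q + 1, 2)%:R != 0 :> {poly rat}.
  by apply: nz; rewrite hn pnatr_eq0 -lt0n bin_gt0; move: hq; lia.
have k0 : k != 0 by rewrite kr; lra.
have K0 : q%:R != 0 :> {poly rat} by apply: nz; rewrite hk.
have K1 : q%:R - 1 != 0 :> {poly rat} by apply: nz; rewrite hornerD hornerN hornerC hk kr; lra.
have K2 : q%:R + 1 != 0 :> {poly rat} by apply: nz; rewrite hornerD hornerC hk kr; lra.
have Km : q%:R ^+ 2 + q%:R + 1 != 0 :> {poly rat}.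
  apply: nz; rewrite !hornerD horner_exp hornerC hk kr.
  have -> : (r + 4) ^+ 2 + (r + 4) + 1 = r ^+ 2 + 9 * r + 21 by ring.
  lra.
have X1 : 'X - 1 != 0 :> {poly rat} by apply: nz; rewrite hornerD hornerN hornerC hornerX; lra.
have Xk : 'X - q%:R != 0 :> {poly rat} by apply: nz; rewrite hornerD hornerN hk hornerX kr; lra.
have N3 : 'X ^+ 2 - (q%:R ^+ 2 - 1) * 'X + 2 * q%:R ^+ 3 - 2 * q%:R ^+ 2 - q%:R + 1 != 0 :>
  {poly rat}.
  apply: nz; rewrite !(hornerD, hornerN, hornerM, horner_exp, hornerX, hornerC, hk, hn) kr.
  have -> : 0 ^+ 2 - ((r + 4) ^+ 2 - 1) * 0 + 2 * (r + 4) ^+ 3 - 2 * (r + 4) ^+ 2 - (r + 4) + 1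
    = 2 * r ^+ 3 + 22 * r ^+ 2 + 79 * r + 93 by ring.
  lra.
have N5 : 'X - (q%:R ^+ 2 - 3 * q%:R + 3) != 0 :> {poly rat}.
  apply: nz; rewrite !(hornerD, hornerN, hornerM, horner_exp, hornerX, hornerC, hk, hn) kr.
  have -> : 0 - ((r + 4) ^+ 2 - 3 * (r + 4) + 3) = - (r ^+ 2 + 5 * r + 7) by ring.
  lra.
have N6 : 2 * 'X ^+ 2 - 2 * (q%:R ^+ 2 - q%:R) * 'X
    + (q%:R ^+ 4 - 4 * q%:R ^+ 3 + 7 * q%:R ^+ 2 - 4 * q%:R) != 0 :> {poly rat}.
  apply: nz; rewrite !(hornerD, hornerN, hornerM, horner_exp, hornerX, hornerC, hk, hn) kr.
  have -> : 2 * 0 ^+ 2 - 2 * ((r + 4) ^+ 2 - (r + 4)) * 0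
      + ((r + 4) ^+ 4 - 4 * (r + 4) ^+ 3 + 7 * (r + 4) ^+ 2 - 4 * (r + 4))
    = r ^+ 4 + 12 * r ^+ 3 + 55 * r ^+ 2 + 116 * r + 96 by ring.
  lra.
have N7 : 6 * 'X ^+ 4 - (6 * q%:R ^+ 2 + 6 * q%:R - 6) * 'X ^+ 3
                  + (3 * q%:R ^+ 4 + 3 * q%:R ^+ 3 - 6 * q%:R) * 'X ^+ 2
                  - (q%:R ^+ 6 - q%:R ^+ 5 + 5 * q%:R ^+ 4 - 5 * q%:R ^+ 3
                     - 6 * q%:R ^+ 2 + 6 * q%:R) * 'X
                  + (q%:R ^+ 7 - 4 * q%:R ^+ 6 + 8 * q%:R ^+ 5 - 5 * q%:R ^+ 4
                     - 6 * q%:R ^+ 3 + 9 * q%:R ^+ 2 - 3 * q%:R) != 0 :> {poly rat}.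
  apply: nz; rewrite !(hornerD, hornerN, hornerM, horner_exp, hornerX, hornerC, hk, hn).
  rewrite !(expr0n, mulr0, oppr0, add0r) /=.
  (* The value at 0 is the combination h1 + 5 h2 + 3 h3 + 3 h4 of the terms bounded here. *)
  have h1 : 0 <= k ^+ 6 * (k - 4) by rewrite mulr_ge0 ?exprn_ge0 ?subr_ge0 // ltW.
  have h2 : 0 <= k ^+ 4 * (k - 1) by rewrite mulr_ge0 ?exprn_ge0 ?subr_ge0 ?ltW //; lra.
  have h3 : 0 <= k ^+ 3 * (k ^+ 2 - 2).
    by rewrite mulr_ge0 ?exprn_ge0 ?ltW // kr sqrrD; lra.
  have h4 : 0 < k * (3 * k - 1) by rewrite mulr_gt0 //; lra.
  lra.
have N8 : 24 * 'X ^+ 4 - 24 * q%:R ^+ 2 * 'X ^+ 3 + (12 * q%:R ^+ 4 - 12 * q%:R) * 'X ^+ 2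
                   - (4 * q%:R ^+ 6 - 4 * q%:R ^+ 5 + 8 * q%:R ^+ 4 - 20 * q%:R ^+ 3
                      + 12 * q%:R ^+ 2) * 'X
                   + (q%:R ^+ 8 - 4 * q%:R ^+ 7 + 11 * q%:R ^+ 6 - 17 * q%:R ^+ 5
                      + 12 * q%:R ^+ 4 - 3 * q%:R ^+ 3) != 0 :> {poly rat}.
  apply: nz; rewrite !(hornerD, hornerN, hornerM, horner_exp, hornerX, hornerC, hk, hn).
  rewrite !(expr0n, mulr0, oppr0, add0r) /=.
  (* The value at 0 is h1 + 11 h2 + 5 h3 + 9 h4 + 3 h5. *)
  have h1 : 0 <= k ^+ 7 * (k - 4) by rewrite mulr_ge0 ?exprn_ge0 ?subr_ge0 // ltW.
  have h2 : 0 <= k ^+ 5 * (k - 2) by rewrite mulr_ge0 ?exprn_ge0 ?subr_ge0 ?ltW //; lra.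
  have h3 : 0 <= k ^+ 5 by rewrite exprn_ge0 ?ltW.
  have h4 : 0 <= k ^+ 4 by rewrite exprn_ge0 ?ltW.
  have h5 : 0 < k ^+ 3 * (k - 1) by rewrite mulr_gt0 ?exprn_gt0 //; lra.
  lra.
rewrite /= andbT; repeat (apply/andP; split); rewrite ?scaler_eq0 ?negb_or.
- exact: oner_neq0.
- exact: mulf_neq0.
- by rewrite !mulf_neq0 // expf_neq0.
- by rewrite !mulf_neq0.
- by rewrite invr_eq0 pnatr_eq0 !mulf_neq0 ?expf_neq0.
- by rewrite invr_eq0 pnatr_eq0 !mulf_neq0 ?expf_neq0.
- by rewrite invr_eq0 pnatr_eq0 !mulf_neq0 ?expf_neq0.
- by rewrite invr_eq0 pnatr_eq0 !mulf_neq0 ?expf_neq0.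
- by rewrite invr_eq0 pnatr_eq0 !mulf_neq0 ?expf_neq0.
Qed.

(** The list is strictly increasing; [4 <= q] places q^2 + q - 3 above q^2. *)
Lemma weights_uniq (q : nat) : (4 <= q)%N -> uniq (weights q).
Proof.
move=> hq; have h : (4 * q <= q ^ 2)%N by nia.
apply: (sorted_uniq ltn_trans ltnn); rewrite /weights /=; move: hq h.
by set u := (q ^ 2)%N; lia.
Qed.

(** * Number of forms with a prescribed number of zeros *)

Section Enumerator.
Variables (F : finFieldType) (q n : nat) (p : 'I_n -> 'rV[F]_3).
Hypotheses (hF : #|F| = q) (hn : n = (q ^ 2 + q + 1)%N) (hp : proj_representatives p).
Hypothesis hq : (4 <= q)%N.
Variables (L : finFieldType) (iota : {rmorphism F -> L}).
Local Notation N u v := ((ntype p iota (u, v)%N)%:R : rat).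

Lemma count_zeros m : (#|[set a : 'rV[L]_6 | #|zeros p iota a| == m]|)%:R =
  (n == m)%:R + N (2 * (q.+1 * q)) (2 * q + 1) * (2 * q + 1 == m)%N%:R
  + N (q.+1 * q) (q + 2) * (q + 2 == m)%N%:R
  + (N (q.+1 * q) (q + 1) + N 0 (q + 1)) * (q + 1 == m)%N%:R
  + N 0 4 * (4 == m)%N%:R + N 0 3 * (3 == m)%N%:R
  + N 0 2 * (2 == m)%N%:R + N 0 1 * (1 == m)%N%:R + N 0 0 * (0 == m)%N%:R :> rat.
Proof.
have := sum_types hF hn hp hq iota (fun t => (t.2 == m)%N%:R); rewrite big_types //= => e.
rewrite mulrDl !addrA -e -sum1_card natr_sum [LHS]big_mkcond /=.
by apply: eq_bigr => a _; rewrite inE; case: (_ == _).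
Qed.

Definition zero_counts := [:: n; 2 * q + 1; q + 2; q + 1; 4; 3; 2; 1; 0]%N.

Lemma zero_counts_weights : [seq (n - w)%N | w <- weights q] = zero_counts.
Proof.
have hqq : (4 * q <= q ^ 2)%N by move: hq; nia.
rewrite /weights /zero_counts /= hn; move: hq hqq; set u := (q ^ 2)%N => h1 h2.
by congr [:: _; _; _; _; _; _; _; _; _]; lia.
Qed.

Lemma count_zeros_nth i : (i < 9)%N ->
  (#|[set a : 'rV[L]_6 | #|zeros p iota a| == nth 0 zero_counts i]|)%:R =
  nth 0 [:: 1; N (2 * (q.+1 * q)) (2 * q + 1); N (q.+1 * q) (q + 2);
     N (q.+1 * q) (q + 1) + N 0 (q + 1); N 0 4; N 0 3; N 0 2; N 0 1; N 0 0] i.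
Proof.
have hn1 : (2 * q + 1 < n)%N by rewrite hn; move: hq; nia.
rewrite count_zeros; clear hn hp hF.
case: i => [|[|[|[|[|[|[|[|[|//]]]]]]]]] _; rewrite /zero_counts /=;
  repeat (case: eqP => [?|?]; [try (by exfalso; lia)|try (by exfalso; lia)]);
  by rewrite ?mulr0 ?mulr1 ?addr0 ?add0r.
Qed.

Lemma count_zeros_notin m : m \notin zero_counts ->
  #|[set a : 'rV[L]_6 | #|zeros p iota a| == m]| = 0%N.
Proof.
rewrite !inE !negb_or => h; apply/eqP; rewrite -(pnatr_eq0 rat) count_zeros.
move: h; rewrite !(eq_sym m).
do 9! [case: (_ == m) => //=].
by rewrite !mulr0 !addr0.
Qed.

Lemma weight_polys_count w : (w <= n)%N ->
  (nth 0 (weight_polys q) (index w (weights q))).[#|L|%:R] =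
  #|[set a : 'rV[L]_6 | #|zeros p iota a| == (n - w)%N]|%:R.
Proof.
move=> hw.
have szw : size (weights q) = 9 by [].
have [hw'|hw'] := boolP (w \in weights q); last first.
  (* For a weight outside the list [index] returns 9, past the end, and [nth] gives the zero
     polynomial. *)
  rewrite nth_default ?horner0; last by rewrite memNindex.
  rewrite count_zeros_notin // -zero_counts_weights; apply: contra hw' => /mapP[v hv].
  (* With [w <= n], this allows the truncated equation n - w = n - v to be cancelled. *)
  have hvn : (v <= n)%N.
    move: hv; rewrite !inE hn; have : (4 * q <= q ^ 2)%N by move: hq; nia.
    by set u := (q ^ 2)%N; move: hq; lia.
  by move=> /eqP; rewrite -(eqn_add2r w) subnK // => /eqP e; suff -> : w = v by []; lia.
have := hw'; rewrite -index_mem szw => hi.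
have <- : nth 0%N zero_counts (index w (weights q)) = (n - w)%N.
  by rewrite -zero_counts_weights (nth_map 0%N) ?index_mem // nth_index.
rewrite count_zeros_nth //.
have [x1 x2 x34 [y4 y3 y2 y1 y0]] := weight_counts hF hn hp hq iota.
rewrite x1 x2 x34 y4 y3 y2 y1 y0; move: (index _ _) hi => i.
have bin2 : 'C(q ^ 2 + q + 1, 2)%:R = (q%:R ^+ 2 + q%:R + 1) * (q%:R ^+ 2 + q%:R) / 2 :> rat.
  have -> : 'C(q ^ 2 + q + 1, 2)%:R = ('C(q ^ 2 + q + 1, 2) * 2)%:R / 2 :> rat by rewrite
    natrM; field.
  have -> : ('C(q ^ 2 + q + 1, 2) * 2 = n * n.-1)%N.
    by have := bin_ffact n 2; rewrite ffactnSr ffactn1 subn1 -hn.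
  by rewrite natr_ff2 (n_rat hn); congr (_ / _); ring.
have hnat (d : nat) : (d%:R : {poly rat}).[#|L|%:R] = d%:R by rewrite hornerMn hornerC.
case: i => [|[|[|[|[|[|[|[|[|//]]]]]]]]] _;
  rewrite /weight_polys [nth _ _ _]/= [nth _ _ _]/=
    !(hornerZ, hornerD, hornerN, hornerM, horner_exp, hornerX, hornerC, hnat).
- by [].
- by rewrite bin2.
- by [].
- by [].
- by rewrite mulrC.
- by rewrite mulrC.
- by rewrite mulrC.
- by rewrite mulrC.
- by rewrite mulrC.
Qed.
End Enumerator.

(** The powers of q are distinct, so as many of them as the size of [P - Q] are too many roots for a
    nonzero difference. *)
Lemma poly_eq_on_powers (q : nat) (P Q : {poly int}) : (1 < q)%N ->
  (forall i, (0 < i)%N -> P.[(q ^ i)%N%:Z] = Q.[(q ^ i)%N%:Z]) -> P = Q.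
Proof.
move=> q1 h; apply/eqP; rewrite -subr_eq0; apply/eqP.
apply: (roots_geq_poly_eq0 (rs := [seq (q ^ i.+1)%N%:Z | i <- iota 0 (size (P - Q))])).
- by apply/allP => _ /mapP[i _ ->]; rewrite /root hornerD hornerN h // subrr.
- rewrite map_inj_uniq ?iota_uniq // => i j [] /eqP.
  by rewrite eqn_exp2l // eqSS => /eqP.
- by rewrite size_map size_iota.
Qed.

Lemma card_ord_in (n : nat) (s : seq nat) : uniq s -> all (fun w => w < n.+1)%N s ->
  #|[set w : 'I_n.+1 | val w \in s]| = size s.
Proof.
move=> us /allP hs; rewrite -(size_map (@inord n)).
have -> : #|[set w : 'I_n.+1 | val w \in s]| = #|[seq (inord w : 'I_n.+1) | w <- s]|.
  apply: eq_card => w; rewrite inE; apply/idP/mapP => [hw|[v hv ->]].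
    by exists (val w); rewrite ?inord_val.
  by rewrite /= inordK ?hs.
apply/card_uniqP; rewrite map_inj_in_uniq // => i j hi hj /(congr1 val) /=.
by rewrite !inordK ?hs.
Qed.

Theorem theorem3p11 (q : nat) (F : finFieldType)
    (pts : 'I_(q ^ 2 + q + 1) -> 'rV[F]_3)
    (hq : (4 <= q)%N) (hF : #|F| = q) (hpts : proj_representatives pts) :
  exists P : nat -> {poly int},
    let n := (q ^ 2 + q + 1)%N in
    let C := veronese_code pts in
    let Z : {poly rat} := 'X in
    let k : {poly rat} := q%:R in
    let PQ w : {poly rat} := map_poly intr (P w) in
    (forall w (Q : {poly int}), (w <= n)%N ->
       is_gen_weight_poly C w Q <-> Q = P w) /\
    #|[set w : 'I_n.+1 | P w != 0]| = 9%N /\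
    PQ 0%N = 1 /\
    PQ (q ^ 2 - q)%N = 'C(q ^ 2 + q + 1, 2)%:R * (Z - 1) /\
    PQ (q ^ 2 - 1)%N = (k ^+ 2 + k + 1) * k ^+ 2 * (Z - k) * (Z - 1) /\
    PQ (q ^ 2)%N =
      (k ^+ 2 + k + 1) * (Z - 1) *
      (Z ^+ 2 - (k ^+ 2 - 1) * Z + 2 * k ^+ 3 - 2 * k ^+ 2 - k + 1) /\
    PQ (q ^ 2 + q - 3)%N =
      24^-1 *: ((k ^+ 2 + k + 1) * (k + 1) * k ^+ 3 * (k - 1) ^+ 2
                * (Z - k) * (Z - 1)) /\
    PQ (q ^ 2 + q - 2)%N =
      6^-1 *: ((k ^+ 2 + k + 1) * (k + 1) * k ^+ 3 * (Z - 1) * (Z - k)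
               * (Z - (k ^+ 2 - 3 * k + 3))) /\
    PQ (q ^ 2 + q - 1)%N =
      4^-1 *: ((k ^+ 2 + k + 1) * (k + 1) * k * (Z - 1) * (Z - k)
               * (2 * Z ^+ 2 - 2 * (k ^+ 2 - k) * Z
                  + (k ^+ 4 - 4 * k ^+ 3 + 7 * k ^+ 2 - 4 * k))) /\
    PQ (q ^ 2 + q)%N =
      6^-1 *: ((k ^+ 2 + k + 1) * (Z - 1)
               * (6 * Z ^+ 4 - (6 * k ^+ 2 + 6 * k - 6) * Z ^+ 3
                  + (3 * k ^+ 4 + 3 * k ^+ 3 - 6 * k) * Z ^+ 2
                  - (k ^+ 6 - k ^+ 5 + 5 * k ^+ 4 - 5 * k ^+ 3
                     - 6 * k ^+ 2 + 6 * k) * Z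
                  + (k ^+ 7 - 4 * k ^+ 6 + 8 * k ^+ 5 - 5 * k ^+ 4
                     - 6 * k ^+ 3 + 9 * k ^+ 2 - 3 * k))) /\
    PQ (q ^ 2 + q + 1)%N =
      24^-1 *: ((Z - 1) * (Z - k)
                * (24 * Z ^+ 4 - 24 * k ^+ 2 * Z ^+ 3
                   + (12 * k ^+ 4 - 12 * k) * Z ^+ 2
                   - (4 * k ^+ 6 - 4 * k ^+ 5 + 8 * k ^+ 4 - 20 * k ^+ 3
                      + 12 * k ^+ 2) * Z
                   + (k ^+ 8 - 4 * k ^+ 7 + 11 * k ^+ 6 - 17 * k ^+ 5
                      + 12 * k ^+ 4 - 3 * k ^+ 3))) /\
    (forall w, (w <= n)%N ->
       w \notin [:: 0; q ^ 2 - q; q ^ 2 - 1; q ^ 2; q ^ 2 + q - 3;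
                    q ^ 2 + q - 2; q ^ 2 + q - 1; q ^ 2 + q;
                    q ^ 2 + q + 1]%N ->
       P w = 0).
Proof.
have [ps eps] := weight_polys_integral q.
have uw := weights_uniq hq.
have szp : size ps = 9 by have := congr1 size eps; rewrite size_map.
(* The default value 0 of [nth] provides the vanishing polynomials for all other weights. *)
pose P w := nth 0 ps (index w (weights q)).
have PE w : map_poly intr (P w) = nth 0 (weight_polys q) (index w (weights q)).
  have [lt|ge] := ltnP (index w (weights q)) (size ps).
    by rewrite -eps (nth_map 0).
  by rewrite szp in ge; rewrite /P !nth_default ?rmorph0 ?szp.
have P0 w : w \notin weights q -> P w = 0.
  by move=> hw; rewrite /P nth_default // memNindex // szp.
have Pneq0 w : w \in weights q -> P w != 0.
  move=> hw; have : map_poly intr (P w) != 0 :> {poly rat}.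
    rewrite PE; apply: (allP (weight_polys_neq0 hq)); apply: mem_nth.
    by have := hw; rewrite -index_mem.
  by apply: contraNneq => ->; rewrite rmorph0.
have Pgen w : (w <= q ^ 2 + q + 1)%N -> is_gen_weight_poly (veronese_code pts) w (P w).
  move=> hw i L iota i1 hL; rewrite card_codewords //.
  have := weight_polys_count hF erefl hpts hq iota hw; rewrite -PE hL.
  have -> : (#|F| ^ i)%:R = ((#|F| ^ i)%N%:Z)%:~R :> rat by rewrite -pmulrn.
  rewrite horner_map /= => e; apply: (@intr_inj rat); rewrite e; by rewrite -pmulrn.
exists P => n C Z k PQ; split.
  move=> w Q hw; split => [hQ|->]; last exact: Pgen.
  apply: (@poly_eq_on_powers q); first by apply: leq_trans hq.
  (* The defining condition at [i] quantifies over fields with q^i elements; the existence of one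
     keeps it from being vacuous and fixes the value of [Q] at q^i. *)
  move=> i i0; have [L [iota hL]] := exists_field_ext F i0.
  by rewrite -hF (hQ i L iota) // (Pgen w hw i L iota).
have hle : all (fun w => w < (q ^ 2 + q + 1).+1)%N (weights q).
  have : (4 * q <= q ^ 2)%N by nia.
  by rewrite /weights /=; set u := (q ^ 2)%N; move: hq; lia.
have PQE i : (i < 9)%N -> PQ (nth 0%N (weights q) i) = nth 0 (weight_polys q) i.
  by move=> hi; rewrite /PQ PE index_uniq.
split.
  rewrite -[RHS]/(size (weights q)) -(card_ord_in uw hle); apply: eq_card => w;
    rewrite [LHS]in_set [RHS]in_set.
  by apply/idP/idP => [|/Pneq0 //]; apply: contraNT => /P0->.
split; first by have := PQE 0%N isT; rewrite /weights /weight_polys [nth _ _ _]/= [nth _ _ _]/=.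
split; first by have := PQE 1%N isT; rewrite /weights /weight_polys [nth _ _ _]/= [nth _ _ _]/=.
split; first by have := PQE 2%N isT; rewrite /weights /weight_polys [nth _ _ _]/= [nth _ _ _]/=.
split; first by have := PQE 3%N isT; rewrite /weights /weight_polys [nth _ _ _]/= [nth _ _ _]/=.
split; first by have := PQE 4%N isT; rewrite /weights /weight_polys [nth _ _ _]/= [nth _ _ _]/=.
split; first by have := PQE 5%N isT; rewrite /weights /weight_polys [nth _ _ _]/= [nth _ _ _]/=.
split; first by have := PQE 6%N isT; rewrite /weights /weight_polys [nth _ _ _]/= [nth _ _ _]/=.
split; first by have := PQE 7%N isT; rewrite /weights /weight_polys [nth _ _ _]/= [nth _ _ _]/=.
split; first by have := PQE 8%N isT; rewrite /weights /weight_polys [nth _ _ _]/= [nth _ _ _]/=.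
by move=> w _; apply: P0.
Qed.
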